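(* Let $\Omega\subset\mathbb R^{1,1}$ be simply connected and let $\nu:\Omega\to\mathbb S^2_1$ be a harmonic immersion, where $\Omega$ carries a Lorentz structure with null coordinates $(x,y)$. Then for every $\rho\in\mathbb R$ with $\rho\ne0,\pm1$ there is a timelike immersion $f:\Omega\to\mathbb H^3_1$ having $\nu$ as its Gauss map and constant extrinsic curvature $$K+1=\rho^2,$$ obtained by integrating $f^{-1}df=\alpha$, where $$\alpha=\frac{[\nu,\nu_x]}{2(1+\rho)}\,dx+\frac{[\nu,\nu_y]}{2(1-\rho)}\,dy.$$ The corresponding constants $r,s$ in $f^{-1}f_x=\tfrac r2[\nu,\nu_x]$, $f^{-1}f_y=\tfrac s2[\nu,\nu_y]$ are $r=\dfrac1{1+\rho}$ and $s=\dfrac1{1-\rho}$.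
   Context: Ambient space. On the space $\mathfrak{gl}(2,\mathbb R)$ of real $2\times2$ matrices let $\langle X,Y\rangle=-\tfrac12\operatorname{tr}(X\bar Y)$, where $\bar Y=(\operatorname{tr}Y)\mathrm{Id}-Y$; then $\langle X,X\rangle=-\det X$. Anti-de Sitter 3-space is $\mathbb H^3_1=\{X:\langle X,X\rangle=-1\}=SL(2,\mathbb R)$ with the induced Lorentzian metric. On $\mathfrak{sl}(2,\mathbb R)$, $\langle X,Y\rangle=\tfrac12\operatorname{tr}(XY)$; put $\mathbb S^2_1=\{X\in\mathfrak{sl}(2,\mathbb R):\langle X,X\rangle=1\}$. All maps are smooth; $\Omega$ is a connected open set with global coordinates $(x,y)$. A map $\nu:\Omega\to\mathbb S^2_1$ is harmonic for the Lorentz structure with null coordinates $(x,y)$ if and only if $[\nu,\nu_{xy}]=0$. An immersion $f:\Omega\to\mathbb H^3_1$ is timelike if the induced metric $I$ is Lorentzian; it has Gauss map $\nu$ if $N=f\nu$ is a unit normal ($\langle N,N\rangle=1$, $N$ orthogonal to $f,f_x,f_y$). The second fundamental form $II$ has coefficients $\langle f_{xx},N\rangle,\langle f_{xy},N\rangle,\langle f_{yy},N\rangle$; the Gaussian curvature $K$ is given by $K+1=\det II/\det I$, and $K+1$ is the extrinsic curvature. *)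

(* Defs.v *)
From HB Require Import structures.
From mathcomp Require Export all_boot all_order all_algebra.
From mathcomp Require Export all_classical all_reals all_analysis.
From mathcomp Require Import ring lra.
Set Implicit Arguments.
Unset Strict Implicit.
Unset Printing Implicit Defensive.
Export Order.TTheory GRing.Theory Num.Theory.
Export numFieldNormedType.Exports.

Local Open Scope classical_set_scope.
Local Open Scope ring_scope.

Section Ambient.
Variable R : realType.
Implicit Types X Y : 'M[R]_2.

Definition mxbar Y : 'M[R]_2 := (\tr Y)%:M - Y.

Definition ip X Y : R := - (2^-1 * \tr (X *m mxbar Y)).

Definition lie X Y : 'M[R]_2 := X *m Y - Y *m X.

Definition AdS3 : set 'M[R]_2 := [set X | ip X X = -1].

Definition sl2 : set 'M[R]_2 := [set X | \tr X = 0].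

Definition S21 : set 'M[R]_2 := [set X | sl2 X /\ ip X X = 1].

Lemma tr2 X : \tr X = X 0 0 + X 1 1.
Proof.
by rewrite /mxtrace big_ord_recl big_ord1; congr (_ + X _ _); apply: val_inj.
Qed.

Lemma mulmx2E X Y i j : (X *m Y) i j = X i 0 * Y 0 j + X i 1 * Y 1 j.
Proof.
rewrite mxE big_ord_recl big_ord1.
by congr (_ + X i _ * Y _ j); apply: val_inj.
Qed.

Lemma mx2P X Y : X = Y <->
  [/\ X 0 0 = Y 0 0, X 0 1 = Y 0 1, X 1 0 = Y 1 0 & X 1 1 = Y 1 1].
Proof.
split=> [->//|[h00 h01 h10 h11]]; apply/matrixP => i j.
have o2 (k : 'I_2) : k = 0 \/ k = 1.
  by case: k => -[|[|//]] hk; [left | right]; apply: val_inj.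
by case: (o2 i) (o2 j) => -> [] ->.
Qed.

Lemma ip_det X : ip X X = - \det X.
Proof.
have -> : \det X = X 0 0 * X 1 1 - X 0 1 * X 1 0.
  rewrite (expand_det_row _ 0) big_ord_recl big_ord1 /cofactor !det_mx11 !mxE /=.
  rewrite expr0 mul1r expr1 mulN1r mulrN.
  by congr (X _ _ * X _ _ - X _ _ * X _ _); apply: val_inj.
rewrite /ip /mxbar !tr2 !mulmx2E !mxE /= !mulr1n !mulr0n; by field.
Qed.

Lemma ip_sl2 X Y : sl2 Y -> ip X Y = 2^-1 * \tr (X *m Y).
Proof.
move=> Y0; rewrite /ip /mxbar Y0 raddf0 sub0r mulmxN raddfN /=.
by rewrite mulrN opprK.
Qed.

End Ambient.

Section Smooth.
Variable R : realType.
Variable V : normedModType R.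
Implicit Types F : R * R -> V.

(* Direction 0 is x and direction 1 is y. *)
Definition dir (i : 'I_2) : R * R := if i == ord0 then (1, 0) else (0, 1).

Definition pd (i : 'I_2) F : R * R -> V := fun p => 'D_(dir i) F p.

Definition dx F := pd ord0 F.
Definition dy F := pd ord_max F.

(* Maps on an open set are represented by total functions, of which only the
   values on that set are used. Differentiability of all iterated partials
   gives their existence and continuity at every order. *)
Definition smooth_on (Omega : set (R * R)) F :=
  forall (w : seq 'I_2) p, Omega p -> differentiable (foldr pd F w) p.

Definition immersion_on (Omega : set (R * R)) F :=
  smooth_on Omega F /\ forall p, Omega p -> injective ('d F p).

End Smooth.

Section SimplyConnected.
Variables (R : realType) (T : topologicalType).

Definition path_connected (A : set T) :=
  forall a b, A a -> A b ->
  exists g : R -> T, [/\ {within `[0, 1], continuous g},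
    forall t, 0 <= t <= 1 -> A (g t), g 0 = a & g 1 = b].

Definition loops_contractible (A : set T) :=
  forall g : R -> T, {within `[0, 1], continuous g} ->
  (forall t, 0 <= t <= 1 -> A (g t)) -> g 0 = g 1 ->
  exists H : R * R -> T,
    [/\ {within `[0, 1] `*` `[0, 1], continuous H},
        forall s t, 0 <= s <= 1 -> 0 <= t <= 1 -> A (H (s, t)),
        forall t, 0 <= t <= 1 -> H (0, t) = g t /\ H (1, t) = g 0 &
        forall s, 0 <= s <= 1 -> H (s, 0) = g 0 /\ H (s, 1) = g 0].

Definition simply_connected (A : set T) :=
  path_connected A /\ loops_contractible A.

End SimplyConnected.

Section Surfaces.
Variable R : realType.
Variable Omega : set (R * R).
Implicit Types nu f : R * R -> 'M[R]_2.

Definition maps_into f (A : set 'M[R]_2) := forall p, Omega p -> A (f p).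

(* [nu, nu_xy] = 0: when (x, y) are null coordinates the tension field of nu is
   proportional to the component of nu_xy tangent to S21, and [lie_S21_eq0]
   below identifies its vanishing with this commutator equation. *)
Definition harmonic nu :=
  forall p, Omega p -> lie (nu p) (dy (dx nu) p) = 0.

Definition fstff f p (v w : R * R) : R := ip ('d f p v) ('d f p w).

(* For a symmetric bilinear form on the plane, this is signature (1, 1). *)
Definition lorentzian (B : R * R -> R * R -> R) :=
  exists u w, [/\ B u u = -1, B w w = 1 & B u w = 0].

Definition timelike_immersion f :=
  [/\ immersion_on Omega f, maps_into f (@AdS3 R) &
      forall p, Omega p -> lorentzian (fstff f p)].

Definition normal_of f nu : R * R -> 'M[R]_2 := fun p => f p *m nu p.

Definition has_gauss_map f nu :=
  forall p, Omega p -> let N := normal_of f nu p in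
  [/\ ip N N = 1, ip N (f p) = 0, ip N (dx f p) = 0 & ip N (dy f p) = 0].

Definition matI f p : 'M[R]_2 := \matrix_(i, j) fstff f p (dir R i) (dir R j).

Definition matII f nu p : 'M[R]_2 :=
  \matrix_(i, j) ip (pd j (pd i f) p) (normal_of f nu p).

Definition gauss_curvature f nu p : R :=
  \det (matII f nu p) / \det (matI f p) - 1.

Definition alpha (rho : R) nu p (v : R * R) : 'M[R]_2 :=
  v.1 *: ((2 * (1 + rho))^-1 *: lie (nu p) (dx nu p)) +
  v.2 *: ((2 * (1 - rho))^-1 *: lie (nu p) (dy nu p)).

End Surfaces.

Lemma lie_S21_eq0 (R : realType) (n X : 'M[R]_2) : S21 n -> sl2 X ->
  lie n X = 0 <-> X - ip X n *: n = 0.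
Proof.
move=> [n0 n1] X0; split=> [|/subr0_eq ->]; last first.
  by rewrite /lie -scalemxAr -scalemxAl subrr.
rewrite ip_sl2 //; move: n1; rewrite ip_sl2 // !tr2 !mulmx2E.
move: n0 X0; rewrite /sl2 /= !tr2 => /eqP; rewrite addr_eq0 => /eqP n0.
move=> /eqP; rewrite addr_eq0 => /eqP X0 n1 /mx2P[].
have E i j : lie n X i j = (n *m X) i j - (X *m n) i j by rewrite /lie !mxE.
have Z i j : (0 : 'M[R]_2) i j = 0 by rewrite mxE.
rewrite !E !mulmx2E n0 X0 !Z => e00 e01 e10 _.
apply/mx2P; rewrite !mxE n0 X0.
move: n1 e00 e01 e10; rewrite n0.
move: (n 1 1) (n 0 1) (n 1 0) (X 1 1) (X 0 1) (X 1 0) => a b c x y z.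
move=> n1 e00 e01 e10.
have k u v : v = 0 -> u * v = 0 :> R by move=> ->; rewrite mulr0.
have n2 : a * a + b * c - 1 = 0 by lra.
have f0 : b * z - c * y = 0 by lra.
have f1 : b * x - a * y = 0 by lra.
have f2 : a * z - c * x = 0 by lra.
have := (k x _ n2, k y _ n2, k z _ n2, k b _ f0, k c _ f0).
have := (k a _ f1, k c _ f1, k a _ f2, k b _ f2).
by move=> [[[? ?] ?] ?] [[[[? ?] ?] ?] ?]; split; lra.
Qed.

(* Main.v *)
(* Put [a = 1 / (2 (1 + rho))] and [b = 1 / (2 (1 - rho))], so that
   [alpha = a [nu, nu_x] dx + b [nu, nu_y] dy]. As nu is harmonic and
   anticommutes with its derivatives, the two sides of the flatness equation of
   [alpha] are [- (a + b) [nu_x, nu_y]] and [- 4 a b [nu_x, nu_y]], which agree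
   for every rho.

   A flat connection [A dx + B dy] integrates on a small square: solve
   [U' = U A] on a horizontal segment, then [V' = V B] on the vertical ones. The
   defect [f (x + h, y) - f (x, y) (1 + h A (x, y))] solves a linear
   equation in [y] up to [O(h^2)] by flatness, so Gronwall's inequality yields
   [f_x = f A]. Local solutions are continued along paths and homotopies as in a
   covering space, and the contractibility of loops makes the continuation
   single-valued.

   The resulting [f] has [f_x = r f nu nu_x] and [f_y = s f nu nu_y], whence its
   first fundamental form is minus that of nu rescaled by r and s, and its second
   fundamental form is off-diagonal with entry [r s rho t], where the triple
   product [t] of [nu, nu_x, nu_y] satisfies [t^2 = - (E G - F^2)] for the
   coefficients of the first form of nu. *)
From HB Require Import structures.
From mathcomp Require Import ring lra.
Require Import Defs.
Set Implicit Arguments.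
Unset Strict Implicit.
Unset Printing Implicit Defensive.

Local Open Scope classical_set_scope.
Local Open Scope ring_scope.

(** * Calculus of matrix-valued maps *)

(** Working in sl(2) makes every uniqueness question algebraic. For a traceless coefficient the
    product [u *m mxbar v] of two solutions is constant, and [mxbar] is inversion on matrices of
    determinant 1. Frames therefore carry their unit determinant everywhere, two of them over the
    same rectangle differ by a constant left factor in SL(2), and Gronwall's inequality serves only
    for estimates.

    The obstacle to a global solution is the shape of Omega: coordinate segments may leave it, so
    the explicit construction stops at a small square. Continuation is organised as lifting of maps
    from rectangles, proved by bisection; a path is the case of a map that ignores one coordinate,
    and a homotopy is the full case.

    Smoothness of f costs no further analysis: f_x = f A and f_y = f B express every partial
    derivative as f times a smooth map. *)

Lemma ord2P (P : 'I_2 -> Prop) : P 0 -> P 1 -> forall i, P i.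
Proof.
move=> P0 P1 [[|[|//]] hi]; [rewrite (_ : Ordinal hi = 0)|rewrite (_ : Ordinal hi = 1)] => //;
  exact: val_inj.
Qed.

Section MatrixCalculus.
Context {R : realType} {V : normedModType R}.
Implicit Types (F G : V -> 'M[R]_2) (x v : V).

Lemma is_derive_mxP F x v (dF : 'M[R]_2) :
  is_derive x v F dF <-> forall i j, is_derive x v (fun y => F y i j) (dF i j).
Proof.
split=> [[DF <-] i j|DF].
  by split; [move/derivable_mxP: DF|rewrite derive_mx// mxE].
have D : derivable F x v by apply/derivable_mxP => i j; case: (DF i j).
split=> //; rewrite derive_mx//; apply/matrixP => i j.
by rewrite mxE; case: (DF i j).
Qed.

Lemma is_derive_mulmx F G x v (dF dG : 'M[R]_2) :
  is_derive x v F dF -> is_derive x v G dG ->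
  is_derive x v (fun y => F y *m G y) (dF *m G x + F x *m dG).
Proof.
move=> /is_derive_mxP DF /is_derive_mxP DG; apply/is_derive_mxP => i j.
rewrite (_ : (fun _ => _) =
   (fun y => F y i 0) * (fun y => G y 0 j) + (fun y => F y i 1) * (fun y => G y 1 j)).
  have h := is_deriveD (is_deriveM (DF i 0) (DG 0 j)) (is_deriveM (DF i 1) (DG 1 j)).
  apply: is_derive_eq h _; rewrite [RHS]mxE !mulmx2E /GRing.scale/=; ring.
by apply/funext => y; rewrite mulmx2E.
Qed.

Lemma differentiable_mxP F x :
  differentiable F x <-> forall i j, differentiable (fun y => F y i j) x.
Proof.
split=> [dF i j|dF].
  exact: (differentiable_comp dF (differentiable_coord _ _ _)).
rewrite (_ : F = \sum_(i < 2) \sum_(j < 2) (fun y => F y i j *: delta_mx i j)).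
  apply: differentiable_sum => i; apply: differentiable_sum => j.
  exact: differentiableZl.
apply/funext => y; rewrite fct_sumE [LHS]matrix_sum_delta.
by apply: eq_bigr => i _; rewrite fct_sumE.
Qed.

Lemma differentiable_mulmx F G x : differentiable F x -> differentiable G x ->
  differentiable (fun y => F y *m G y) x.
Proof.
move=> /differentiable_mxP dF /differentiable_mxP dG.
apply/differentiable_mxP => i j.
rewrite (_ : (fun _ => _) =
   (fun y => F y i 0) * (fun y => G y 0 j) + (fun y => F y i 1) * (fun y => G y 1 j)).
  by apply: differentiableD; apply: differentiableM.
by apply/funext => y; rewrite mulmx2E.
Qed.

Lemma diff_is_derive F x v : differentiable F x -> is_derive x v F ('d F x v).
Proof. by move=> dF; split; [exact: diff_derivable|exact: deriveE]. Qed.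

Lemma diff_mulmx F G x v : differentiable F x -> differentiable G x ->
  'd (fun y => F y *m G y) x v = 'd F x v *m G x + F x *m 'd G x v.
Proof.
move=> dF dG.
have [_ D1] := diff_is_derive v (differentiable_mulmx dF dG).
have [_ D2] := is_derive_mulmx (diff_is_derive v dF) (diff_is_derive v dG).
exact: etrans (esym D1) D2.
Qed.

End MatrixCalculus.

Section MatrixNorm.
Context {R : realType}.
Implicit Types (M N : 'M[R]_2).

Lemma ler_mx_entry M i j : `|M i j| <= `|M|.
Proof.
by rewrite [leRHS]/Num.Def.normr/= mx_normrE; exact: (le_bigmax _ _ (i, j)).
Qed.

Lemma mx_norm_le M c : 0 <= c -> (forall i j, `|M i j| <= c) -> `|M| <= c.
Proof.
by move=> c0 Mc; rewrite [leLHS]/Num.Def.normr/= mx_normrE bigmax_le.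
Qed.

(** The norm is the largest absolute entry, and an entry of the product is a sum of two products.
    This factor 2 enters all numerical constants of the estimates below. *)
Lemma mx_norm_mul M N : `|M *m N| <= 2 * `|M| * `|N|.
Proof.
apply: mx_norm_le => [|i j]; first by rewrite !mulr_ge0.
rewrite mulmx2E (le_trans (ler_normD _ _))// !normrM.
rewrite (_ : 2 * _ * _ = `|M| * `|N| + `|M| * `|N|); last by ring.
by rewrite lerD// ler_pM// ler_mx_entry.
Qed.

Lemma mx_norm1_le : `|1%:M : 'M[R]_2| <= 1.
Proof.
by apply: mx_norm_le => // i j; rewrite mxE; case: eqP; rewrite ?normr1 ?normr0.
Qed.

Lemma mx_norm_mul_le M N a b : `|M| <= a -> `|N| <= b -> `|M *m N| <= 2 * a * b.
Proof.
move=> Ma Nb; rewrite (le_trans (mx_norm_mul _ _))// -!mulrA ler_pM2l//.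
by rewrite ler_pM.
Qed.

Lemma continuous_norm_mx (T : topologicalType) (u : T -> 'M[R]_2) t :
  {for t, continuous u} -> {for t, continuous (fun t => `|u t|)}.
Proof. by move=> cu; apply: cvg_norm. Qed.

End MatrixNorm.

Section MeanValue.
Context {R : realType}.
Implicit Types (u du : R -> 'M[R]_2) (a b s t d : R).

Lemma is_derive_continuous (W : normedModType R) (g : R -> W) (t : R) (dg : W) :
  is_derive t 1 g dg -> {for t, continuous g}.
Proof. by move=> [/derivable1_diffP /differentiable_continuous]. Qed.

(** For the norm of largest entries, the scalar mean value theorem can be applied entry by entry:
    the intermediate points may differ. *)
Lemma mx_mean_value u du a b (C : R) : a <= b -> 
  (forall t, a <= t <= b -> is_derive t 1 u (du t)) ->
  (forall t, a <= t <= b -> `|du t| <= C) -> `|u b - u a| <= C * (b - a).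
Proof.
move=> ab Du duC.
have C0 : 0 <= C by rewrite (le_trans _ (duC a _))// lexx.
apply: mx_norm_le => [|i j]; first by rewrite mulr_ge0// subr_ge0.
have D t : a <= t <= b -> is_derive t 1 (fun t => u t i j) (du t i j).
  by move=> /Du /is_derive_mxP.
have [] := @MVT_segment R (fun t => u t i j) (fun t => du t i j) _ _ ab.
- move=> t; rewrite in_itv/= => /andP[ta tb].
  by apply: D; rewrite !ltW.
- apply: continuous_in_subspaceT => t; rewrite inE/= in_itv/= => /D.
  exact: is_derive_continuous.
move=> c; rewrite in_itv/= => cab e; rewrite !mxE e normrM.
rewrite [`|b - a|]ger0_norm ?subr_ge0// ler_wpM2r ?subr_ge0//.
exact: le_trans (ler_mx_entry _ _ _) (duC _ _).
Qed.

Lemma mx_mean_value_dist u du (t0 d C s t : R) :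
  (forall t, `|t - t0| <= d -> is_derive t 1 u (du t)) ->
  (forall t, `|t - t0| <= d -> `|du t| <= C) ->
  `|s - t0| <= d -> `|t - t0| <= d -> `|u t - u s| <= C * `|t - s|.
Proof.
move=> Du duC; wlog st : s t / s <= t => [hw|].
  move=> sd td; case/orP: (le_total s t) => st; first exact: hw.
  by rewrite distrC [`|t - s|]distrC; apply: hw.
move=> /ler_normlP[h1 h2] /ler_normlP[h3 h4].
have b x : s <= x <= t -> `|x - t0| <= d.
  by move=> /andP[? ?]; apply/ler_normlP; split; lra.
rewrite (ger0_norm (_ : 0 <= t - s)) ?subr_ge0//.
apply: mx_mean_value st _ _ => x xst; [exact/Du/b|exact/duC/b].
Qed.

Lemma gronwall_short u du (t0 d K c t : R) :
  (forall t, `|t - t0| <= d -> is_derive t 1 u (du t)) ->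
  (forall t, `|t - t0| <= d -> `|du t| <= K * `|u t| + c) ->
  0 <= K -> 2 * K * d <= 1 ->
  `|t - t0| <= d -> `|u t| <= 2 * (`|u t0| + d * c).
Proof.
move=> Du duC K0 Kd td; have d0 : 0 <= d by rewrite (le_trans _ td).
have dE s : (`|s - t0| <= d) = (s \in `[t0 - d, t0 + d]).
  rewrite in_itv/=; apply/ler_normlP/andP => -[? ?]; split; lra.
have [] := @EVT_max R (fun t => `|u t|) (t0 - d) (t0 + d).
- lra.
- apply: continuous_in_subspaceT => s; rewrite inE/= -dE => /Du Ds.
  exact/continuous_norm_mx/(is_derive_continuous Ds).
move=> m; rewrite -dE => md um.
have t0d : `|t0 - t0| <= d by rewrite subrr normr0.
have um0 : 0 <= `|u m| by [].
have c1 : 0 <= K * `|u m| + c by rewrite (le_trans _ (duC m md)).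
have : `|u m - u t0| <= (K * `|u m| + c) * `|m - t0|.
  apply: (mx_mean_value_dist Du) t0d md => s sd.
  rewrite (le_trans (duC _ sd))// lerD2r ler_wpM2l//.
  by apply: um; rewrite -dE.
have := ler_normD (u m - u t0) (u t0); rewrite subrK => h1 h2.
have h3 : (K * `|u m| + c) * `|m - t0| <= (K * `|u m| + c) * d.
  by rewrite ler_wpM2l.
have := um t; rewrite -dE => /(_ td) h4.
have : 0 <= (1 - 2 * K * d) * `|u m| by rewrite mulr_ge0// subr_ge0.
by lra.
Qed.

End MeanValue.

(** * Linear differential equations *)

Section LinearODE.
Context {R : realType}.

Lemma primitive_segment (g : R -> R) (a b : R) : continuous g ->
  exists G : R -> R, forall t, a <= t <= b -> is_derive t 1 G (g t).
Proof.
(* The interval is enlarged by 1 at both ends, so that every point of [a, b] is interior and the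
   derivative is two-sided. *)
move=> cg; exists (fun x => (\int[lebesgue_measure]_(t in [set` `[a - 1, x]]) (g t))%R).
move=> t /andP[ta tb].
have [] := @continuous_FTC1_closed R g (a - 1) t (b + 1) _ _ _ (cg t).
- lra.
- apply: continuous_compact_integrable; first exact: segment_compact.
  exact: continuous_subspaceT.
- lra.
by move=> D; rewrite derive1E => E; split.
Qed.

Lemma mx_primitive (w : R -> 'M[R]_2) (t0 d : R) : continuous w ->
  exists P : R -> 'M[R]_2,
    P t0 = 0 /\ forall t, `|t - t0| <= d -> is_derive t 1 P (w t).
Proof.
move=> cw.
have h (ij : 'I_2 * 'I_2) : exists G : R -> R,
    forall t, t0 - d <= t <= t0 + d -> is_derive t 1 G (w t ij.1 ij.2).
  apply: primitive_segment => t.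
  exact: (@continuous_comp _ _ _ w (fun M : 'M[R]_2 => M ij.1 ij.2) _ (cw t)
    (@coord_continuous _ _ _ _ _ _)).
have [G DG] := choice h.
exists (fun t => \matrix_(i, j) (G (i, j) t - G (i, j) t0)).
split; first by apply/matrixP => i j; rewrite !mxE subrr.
move=> t /ler_normlP[h1 h2]; apply/is_derive_mxP => i j.
rewrite (_ : (fun _ => _) = G (i, j) - cst (G (i, j) t0)); last first.
  by apply/funext => s; rewrite mxE.
have ? := DG (i, j) t ltac:(apply/andP; split; lra).
by apply: is_derive_eq; rewrite subr0.
Qed.

(** For d >= 0, composing with this retraction extends a map from the interval of radius d to the
    whole line, with the same bound. *)
Definition clamp (t0 d t : R) := Num.max (t0 - d) (Num.min (t0 + d) t).

Lemma clamp_dist t0 d t : 0 <= d -> `|clamp t0 d t - t0| <= d.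
Proof.
move=> d0; apply/ler_normlP; rewrite /clamp maxEle minEle.
by case: (leP (t0 + d) t) => ?; case: (leP (t0 - d)) => ?; split; lra.
Qed.

Lemma clamp_id t0 d t : `|t - t0| <= d -> clamp t0 d t = t.
Proof.
move=> /ler_normlP[? ?]; rewrite /clamp maxEle minEle.
by case: (leP (t0 + d) t) => ?; case: (leP (t0 - d)) => ?; lra.
Qed.

Lemma clamp_continuous t0 d : continuous (clamp t0 d).
Proof.
move=> t; apply: (@continuous_max _ _ (cst (t0 - d)) (fun t => Num.min (t0 + d) t)).
  exact: cst_continuous.
apply: (@continuous_min _ _ (cst (t0 + d)) id); first exact: cst_continuous.
exact: cvg_id.
Qed.

Lemma geometric_small (c e : R) : 0 < e -> exists n, c * 2^-1 ^+ n < e.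
Proof.
move=> e0; have g0 : (c * 2^-1 ^+ n : R) @[n --> \oo] --> (0 : R).
  rewrite -[X in _ --> X](mulr0 c); apply: cvgMr; apply: cvg_expr.
  by rewrite gtr0_norm; lra.
exact: filter_ex (cvgr_lt _ g0 _ e0).
Qed.

Lemma geometric_limit (x : nat -> 'M[R]_2) :
  (forall n, `|x n.+1 - x n| <= 2^-1 ^+ n) ->
  exists l, forall n, `|x n - l| <= 2 * 2^-1 ^+ n.
Proof.
move=> hx.
(* The subtracted term is what makes the induction on k close. *)
have tail n k : `|x (n + k)%N - x n| <= 2 * 2^-1 ^+ n - 2 * 2^-1 ^+ (n + k).
  elim: k => [|k IH]; first by rewrite addn0 !subrr normr0.
  rewrite addnS -(subrKA (x (n + k)%N)) (le_trans (ler_normD _ _))//.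
  rewrite (le_trans (lerD (hx _) IH))// exprS; lra.
have tail' n m : (n <= m)%N -> `|x m - x n| <= 2 * 2^-1 ^+ n.
  move=> /subnKC <-; rewrite (le_trans (tail _ _))// lerBlDr lerDl.
  by rewrite mulr_ge0// exprn_ge0.
have : cvgn x.
  apply/cauchy_cvgP/cauchy_exP => e e0.
  have [N hN] := geometric_small 2 e0.
  exists (x N); exists N => // m /= Nm; rewrite -ball_normE/= distrC.
  exact: le_lt_trans (tail' _ _ Nm) hN.
move=> /cvg_ex[l xl]; exists l => n.
have h : `|x n - x m| @[m --> \oo] --> `|x n - l|.
  by apply: cvg_norm; apply: cvgB => //; exact: cvg_cst.
apply: (cvgr_to_le h); near=> m; rewrite distrC; apply: tail'.
by near: m; exact: nbhs_infty_ge.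
Unshelve. all: by end_near. Qed.

Lemma le_geometric0 (x c : R) : (forall n, x <= c * 2^-1 ^+ n) -> x <= 0.
Proof.
move=> xc; case: leP => // x0.
by have [n] := geometric_small c x0; rewrite ltNge xc.
Qed.

Lemma cvg_mulmx (T : Type) (F : set_system T) (FF : Filter F)
    (f g : T -> 'M[R]_2) (a b : 'M[R]_2) :
  f @ F --> a -> g @ F --> b -> (f x *m g x) @[x --> F] --> a *m b.
Proof.
apply: (@continuous2_cvg _ _ _ _ _ _ _ _ (fun M N : 'M[R]_2 => M *m N)).
suff : differentiable (fun z : 'M[R]_2 * 'M[R]_2 => z.1 *m z.2) (a, b).
  exact: differentiable_continuous.
apply: differentiable_mulmx.
  by apply: linear_differentiable => z; exact: cvg_fst.
by apply: linear_differentiable => z; exact: cvg_snd.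
Qed.

(* The Picard iterates are composed with [clamp] so that they are defined,
   bounded and continuous on the whole line. *)
Lemma linear_ode (A : R -> 'M[R]_2) (t0 d K : R) :
  0 <= d -> continuous A -> (forall t, `|A t| <= K) -> 4 * K * d <= 1 ->
  exists u : R -> 'M[R]_2, u t0 = 1%:M /\
    forall t, `|t - t0| < d -> is_derive t 1 u (u t *m A t).
Proof.
move=> d0 cA AK Kd; have K0 : 0 <= K by rewrite (le_trans _ (AK 0)).
(* [choice] needs a value for every w; a discontinuous w receives itself as a default. *)
have exP (w : R -> 'M[R]_2) : exists P : R -> 'M[R]_2, continuous w ->
    P t0 = 0 /\ forall t, `|t - t0| <= d -> is_derive t 1 P (w t).
  have [cw|ncw] := pselect (continuous w); last by exists w.
  by have [P hP] := mx_primitive t0 d cw; exists P.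
have [Prim hPrim] := choice exP.
have t0d : `|t0 - t0| <= d by rewrite subrr normr0.
pose step (w : R -> 'M[R]_2) t := 1%:M + Prim (fun s => w s *m A s) (clamp t0 d t).
have cmul (w : R -> 'M[R]_2) : continuous w -> continuous (fun s => w s *m A s).
  by move=> cw s; apply: cvg_mulmx; [exact: cw|exact: cA].
have cstep w : continuous w -> continuous (step w).
  move=> cw t; apply: cvgD; first exact: cvg_cst.
  apply: (@continuous_comp _ _ _ (clamp t0 d)); first exact: clamp_continuous.
  have [_ D] := hPrim _ (cmul _ cw).
  exact: is_derive_continuous (D _ (clamp_dist _ _ _)).
(* The difference has derivative at most 2 c K and vanishes at t0. Over a distance d this gives 2 c
   K d, at most c / 2 since 4 K d <= 1. *)
have stepd v w c : continuous v -> continuous w ->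
    (forall t, `|v t - w t| <= c) -> forall t, `|step v t - step w t| <= 2^-1 * c.
  move=> cv cw vwc t; rewrite /step opprD addrACA subrr add0r.
  have [Pv Dv] := hPrim _ (cmul _ cv); have [Pw Dw] := hPrim _ (cmul _ cw).
  set x := clamp _ _ _.
  pose D := Prim (fun s => v s *m A s) - Prim (fun s => w s *m A s).
  have xd : `|x - t0| <= d by exact: clamp_dist.
  have : `|D x - D t0| <= (2 * c * K) * `|x - t0|.
    apply: (mx_mean_value_dist (u := D)
      (du := fun s => v s *m A s - w s *m A s)) t0d xd => s sd.
      have := Dv _ sd; have := Dw _ sd => *; exact: is_deriveB.
    by rewrite -mulmxBl; apply: mx_norm_mul_le.
  have -> : D t0 = 0 by rewrite -[LHS]/(Prim _ t0 - Prim _ t0) Pv Pw subr0.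
  rewrite subr0 => /le_trans; apply.
  have c0 : 0 <= c by rewrite (le_trans _ (vwc 0)).
  have : (2 * c * K) * `|x - t0| <= (2 * c * K) * d.
    by rewrite ler_wpM2l// !mulr_ge0.
  have : 0 <= c * (1 - 4 * K * d) by rewrite mulr_ge0// subr_ge0.
  by lra.
pose U n := iter n step (cst 1%:M).
have cU n : continuous (U n).
  by elim: n => [|n IH]; [exact: cst_continuous|exact: (cstep _ IH)].
have UU n t : `|U n.+1 t - U n t| <= 2^-1 ^+ n.
  elim: n t => [|n IH] t; last by rewrite exprS; exact: (stepd _ _ _ (cU _) (cU _) IH).
  have [P0 D] := hPrim _ (cmul (cst 1%:M) (fun=> @cst_continuous _ _ _ _)).
  rewrite expr0 /U/= /step addrC addKr; set x := clamp _ _ _.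
  have xd : `|x - t0| <= d by exact: clamp_dist.
  rewrite -[X in `|X|]subr0 -P0.
  apply: (le_trans (mx_mean_value_dist D (C := K) _ t0d xd)).
    by move=> s _; rewrite mul1mx.
  have : K * `|x - t0| <= K * d by rewrite ler_wpM2l.
  have : 0 <= K * d by rewrite mulr_ge0.
  by lra.
have exu t : exists l, forall n, `|U n t - l| <= 2 * 2^-1 ^+ n.
  by apply: geometric_limit => n.
have [u Uu] := choice exu.
have cu : continuous u.
  move=> t; apply/cvgrPdist_lt => e e0.
  have [n hn] := geometric_small 2 (divr_gt0 e0 (ltr0n R 4)).
  near=> s; rewrite -(subrKA (U n t)) (le_lt_trans (ler_normD _ _))//.
  rewrite -(subrKA (U n s) (U n t)).
  have h : `|U n t - U n s| < e / 2.
    by near: s; apply: cvgr_dist_lt; [exact: cU|exact: divr_gt0].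
  have := ler_normD (U n t - U n s) (U n s - u s).
  have := Uu t n; have := Uu s n; rewrite [`|U n t - u t|]distrC.
  lra.
(* Both sides are close to [U n.+1 t]: the left within 2 * 2^-(n+1) by the choice of u, the right
   within 2^-1 * (2 * 2^-n) by contraction. *)
have fix_u t : u t = step u t.
  apply/eqP; rewrite -subr_eq0 -normr_le0; apply: (@le_geometric0 _ 2) => n.
  rewrite -(subrKA (U n.+1 t)) (le_trans (ler_normD _ _))//.
  have := Uu t n.+1; rewrite distrC exprS.
  have := stepd _ _ _ (cU n) cu (fun t => Uu t n) t; rewrite -/(U n.+1); lra.
have [P0 DP] := hPrim _ (cmul _ cu).
exists u; split; first by rewrite fix_u /step clamp_id// P0 addr0.
move=> t td.
have D := is_deriveD (is_derive_cst (1%:M : 'M[R]_2) t (1 : R)) (DP t (ltW td)).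
rewrite add0r in D; apply: near_eq_is_derive D.
  (* The clamp is the identity on a whole neighbourhood of t only for t in the open interval, hence
     the strict inequality in the conclusion. *)
  near=> s; rewrite fix_u /step clamp_id//.
  apply: ltW; near: s; apply: cvgr_lt td.
  by apply: cvg_norm; apply: cvgB; [exact: cvg_id|exact: cvg_cst].
Unshelve. all: by end_near. Qed.

End LinearODE.

(** * Smooth maps of the plane *)

Section DifferentialEps.
Context {R : realType} {V W : normedModType R}.
Implicit Types (F G : V -> W) (p : V).

Lemma differentiable_eps F p : differentiable F p ->
  forall e, 0 < e -> \forall h \near 0, `|F (h + p) - F p - 'd F p h| <= e * `|h|.
Proof.
move=> /diff_locallyP[_ /eqaddoP] Fp e /Fp; apply: filterS => h /=.
by rewrite opprD addrA.
Qed.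

Lemma eps_is_diff F p (L : {linear V -> W}) : continuous L ->
  (forall e, 0 < e -> \forall h \near 0, `|F (h + p) - F p - L h| <= e * `|h|) ->
  differentiable F p /\ 'd F p = L :> (V -> W).
Proof.
move=> cL FL.
have E : F \o shift p = cst (F p) + L +o_ 0 id.
  apply/eqaddoP => e /FL; apply: filterS => h /=.
  by rewrite [X in _ -> is_true (`|X| <= _)](_ : _ = F (h + p) - (F p + L h))// opprD addrA.
have dE : 'd F p = L :> (V -> W) by exact: diff_unique.
by split=> //; apply/diff_locallyP; rewrite dE.
Qed.

(** Differentiability depends on the germ alone, so values off an open Omega never matter. *)
Lemma near_eq_differentiable F G p :
  (\forall q \near p, F q = G q) -> differentiable F p -> differentiable G p.
Proof.
move=> FG dF.
apply: (proj1 (eps_is_diff (F := G) (L := 'd F p) (diff_continuous dF) _)).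
move=> e e0.
have FGp : F p = G p by exact: (nbhs_singleton FG).
near=> h.
have <- : F (h + p) = G (h + p).
  near: h; move: FG; rewrite (near_shift 0)/=.
  by apply: filterS => h; rewrite /= subr0.
by rewrite -FGp; near: h; exact: differentiable_eps.
Unshelve. all: by end_near. Qed.

Lemma is_derive_line F (u w : V) (s : R) : differentiable F (s *: u + w) ->
  is_derive s 1 (fun t : R => F (t *: u + w)) ('d F (s *: u + w) u).
Proof.
move=> dF.
have da : is_diff s (fun t : R => t *: u + w) (fun t : R => t *: u).
  have := is_diffD (is_diff_scalel s u) (is_diff_cst w s).
  by move=> /= [d1 d2]; split; [exact: d1|rewrite d2; apply/funext => t /=; rewrite addr0].
have dFa : differentiable (fun t : R => F (t *: u + w)) s.
  by apply: (@differentiable_comp _ _ _ _ (fun t : R => t *: u + w)) => //; case: da.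
split; first exact: diff_derivable.
rewrite deriveE// (@diff_comp _ _ _ _ (fun t : R => t *: u + w))//=.
by rewrite (@diff_val _ _ _ _ _ _ _ da) scale1r.
Qed.

End DifferentialEps.

(** * Symmetry of second partial derivatives *)

Section MixedPartials.
Context {R : realType} {V : normedModType R}.
Implicit Types (g : V -> R) (p u v : V).

(** The mean value theorem in the direction u, applied to the difference of g along two parallel
    segments, leaves h times an increment of ['D_u g]; differentiability of ['D_u g] at p expands
    that increment to first order. *)
Lemma second_difference g p u v e : 0 < e ->
  (\forall q \near p, differentiable g q) -> differentiable ('D_u g) p ->
  \forall h \near (0 : R)^'+,
    `|g (h *: u + (h *: v + p)) - g (h *: u + p) - (g (h *: v + p) - g p)
      - h ^+ 2 * 'D_v ('D_u g) p| <= 2 * e * (`|u| + `|v|) * h ^+ 2.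
Proof.
move=> e0 dg dgu; set N := `|u| + `|v|.
have N0 : 0 <= N by rewrite addr_ge0.
have dgu_eps := differentiable_eps dgu e0.
have : \forall k \near (0 : V), differentiable g (k + p) /\
    `|'D_u g (k + p) - 'D_u g p - 'd ('D_u g) p k| <= e * `|k|.
  near=> k; split; last by near: k.
  near: k; move: dg; rewrite (near_shift 0)/=.
  by apply: filterS => h; rewrite /= subr0.
move=> /nbhs_ballP[r /= r0 hr].
have {}hr k : `|k| < r -> differentiable g (k + p) /\
    `|'D_u g (k + p) - 'D_u g p - 'd ('D_u g) p k| <= e * `|k|.
  by move=> kr; apply: hr; rewrite -ball_normE/= sub0r normrN.
near=> h.
have h0 : 0 < h by near: h; exact: nbhs_right_gt.
have hN : h * N < r.
  have : h < r / (N + 1) by near: h; apply: nbhs_right_lt; rewrite divr_gt0// ltr_wpDl.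
  rewrite ltr_pdivlMr ?ltr_wpDl//; apply: le_lt_trans.
  by rewrite ler_wpM2l ?lerDl// ltW.
have small s t : 0 <= s <= h -> 0 <= t <= h -> `|s *: u + t *: v| <= h * N.
  move=> /andP[s0 sh] /andP[t0 th]; rewrite (le_trans (ler_normD _ _))// !normrZ.
  by rewrite (ger0_norm s0) (ger0_norm t0) /N mulrDr lerD// ler_wpM2r.
have D t s : 0 <= s <= h -> 0 <= t <= h ->
    is_derive s 1 (fun s : R => g (s *: u + (t *: v + p))) ('D_u g (s *: u + (t *: v + p))).
  move=> sh th; have [+ _] := hr _ (le_lt_trans (small _ _ sh th) hN).
  by rewrite -addrA => dq; rewrite deriveE//; exact: is_derive_line.
(* The summand [0 *: v] keeps both terms in the form covered by [D]. *)
pose phi (s : R) := g (s *: u + (h *: v + p)) - g (s *: u + (0 *: v + p)).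
have hh : 0 <= h <= h by rewrite lexx ltW.
have h00 : 0 <= (0 : R) <= h by rewrite lexx ltW.
have Dphi s : 0 <= s <= h -> is_derive s 1 phi
    ('D_u g (s *: u + (h *: v + p)) - 'D_u g (s *: u + (0 *: v + p))).
  by move=> sh; have := D h s sh hh; have := D 0 s sh h00 => *; exact: is_deriveB.
have [] := @MVT_segment R phi
  (fun s => 'D_u g (s *: u + (h *: v + p)) - 'D_u g (s *: u + (0 *: v + p))) 0 h.
- exact: ltW.
- by move=> s; rewrite in_itv/= => /andP[? ?]; apply: Dphi; rewrite !ltW.
- apply: continuous_in_subspaceT => s; rewrite inE/= in_itv/= => /Dphi.
  exact: is_derive_continuous.
move=> s; rewrite in_itv/= => sh; rewrite subr0 /phi !scale0r !add0r => ->.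
rewrite !addrA.
have [_ e1] := hr _ (le_lt_trans (small _ _ sh hh) hN).
have [_ e2] := hr _ (le_lt_trans (small _ _ sh h00) hN).
have n1 := small _ _ sh hh; have n2 := small _ _ sh h00.
have l1 : 'd ('D_u g) p (s *: u) = s * 'd ('D_u g) p u by rewrite linearZ.
have l2 : 'd ('D_u g) p (s *: u + h *: v) = s * 'd ('D_u g) p u + h * 'd ('D_u g) p v.
  by rewrite linearD !linearZ.
move: e1 e2 n1 n2; rewrite scale0r addr0 l1 l2 (deriveE v dgu).
set a := 'D_u g (_ + _ *: v + p); set b := 'D_u g (s *: u + p); set c := 'D_u g p.
set x := 'd _ _ u; set y := 'd _ _ v.
move=> e1 e2 n1 n2.
have {}e1 := le_trans e1 (ler_wpM2l (ltW e0) n1).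
have {}e2 := le_trans e2 (ler_wpM2l (ltW e0) n2).
have E : (a - b) * h - h ^+ 2 * y =
   h * ((a - c - (s * x + h * y)) - (b - c - s * x)) by ring.
rewrite E normrM (ger0_norm (ltW h0)).
have := ler_normB (a - c - (s * x + h * y)) (b - c - s * x) => e3.
have -> : 2 * e * N * h ^+ 2 = h * (e * (h * N) + e * (h * N)) by ring.
by rewrite ler_pM2l// (le_trans e3)// lerD.
Unshelve. all: by end_near. Qed.

(** The second difference is symmetric in u and v, so h^2 times either mixed derivative approximates
    the same number. *)
Lemma mixed_partials g p u v :
  (\forall q \near p, differentiable g q) ->
  differentiable ('D_u g) p -> differentiable ('D_v g) p ->
  'D_v ('D_u g) p = 'D_u ('D_v g) p.
Proof.
move=> dg dgu dgv; apply/eqP; rewrite -subr_eq0 -normr_le0.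
set N := `|u| + `|v|; have N0 : 0 <= N by rewrite addr_ge0.
apply/ler_addgt0Pr => e e0; rewrite add0r.
(* The two errors add up to 4 e1 N h^2 = e (N / (N + 1)) h^2, which is at most e h^2; the added 1
   covers N = 0. *)
pose e1 := e / (4 * (N + 1)).
have e10 : 0 < e1 by rewrite divr_gt0// mulr_gt0// ltr_wpDl.
have h1 := second_difference v e10 dg dgu.
have h2 := second_difference u e10 dg dgv.
have [h [[d1 d2] h0]] := filter_ex (filterI (filterI h1 h2) (nbhs_right_gt (0 : R))).
move: d1 d2; rewrite (addrCA (h *: u)) (addrC `|v|) -/N.
set a := g _; set b := g (_ + p); set c := g (_ + p); set d := g p.
set x := 'D_v _ _; set y := 'D_u _ _ => d1 d2.
have h20 : 0 < h ^+ 2 by rewrite exprn_gt0.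
rewrite -(ler_pM2r h20) -{1}[h ^+ 2]gtr0_norm// -normrM.
have -> : (x - y) * h ^+ 2 = (a - c - (b - d) - h ^+ 2 * y) - (a - b - (c - d) - h ^+ 2 * x).
  by ring.
rewrite (le_trans (ler_normB _ _))// (le_trans (lerD d2 d1))// -mulrDl ler_pM2r//.
have -> : 2 * e1 * N + 2 * e1 * N = e * (N / (N + 1)).
  by rewrite /e1; field; rewrite gt_eqF// ltr_wpDl.
by apply: ler_piMr; [exact: ltW|rewrite ler_pdivrMr ?ltr_wpDl// mul1r lerDl].
Qed.

End MixedPartials.

Section SmoothOn.
Context {R : realType} (Omega : set (R * R)) (oO : open Omega).

Lemma near_open (P : R * R -> Prop) p : Omega p -> (forall q, Omega q -> P q) ->
  \forall q \near p, P q.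
Proof.
move=> Op OP; apply: (filterS OP); exact: open_nbhs_nbhs.
Qed.

Lemma foldr_pd_ext (W : normedModType R) (F G : R * R -> W) :
  (forall p, Omega p -> F p = G p) ->
  forall w p, Omega p -> foldr (@pd R W) F w p = foldr (@pd R W) G w p.
Proof.
move=> FG; elim=> [|i w IH] p Op /=; first exact: FG.
by apply: near_eq_derive; exact: near_open.
Qed.

Lemma smooth_on_ext (W : normedModType R) (F G : R * R -> W) :
  (forall p, Omega p -> F p = G p) -> smooth_on Omega F -> smooth_on Omega G.
Proof.
move=> FG sF w p Op; apply: near_eq_differentiable (sF w p Op).
by apply: near_open Op _ => q Oq; exact: foldr_pd_ext.
Qed.

(** The last letter of a word acts first, so iterating on [pd i F] along [w] is iterating on [F]
    along [rcons w i]. *)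
Lemma smooth_on_pd (W : normedModType R) (F : R * R -> W) i :
  smooth_on Omega F -> smooth_on Omega (pd i F).
Proof. by move=> sF w p Op; have := sF (rcons w i) p Op; rewrite foldr_rcons. Qed.

(** Replaces formulas for iterated derivatives: it suffices to find an invariant class of
    differentiable maps. Closure is asked up to equality on Omega because differentiation rules hold
    only there. *)
Lemma smooth_on_closed (W : normedModType R) (C : (R * R -> W) -> Prop) :
  (forall F p, C F -> Omega p -> differentiable F p) ->
  (forall F i, C F -> exists2 G, C G & forall p, Omega p -> G p = pd i F p) ->
  forall F, C F -> smooth_on Omega F.
Proof.
move=> dC pC F CF w; elim/last_ind: w F CF => [|w i IH] F CF p Op; first exact: dC.
have [G CG GF] := pC F i CF.
rewrite foldr_rcons; apply: near_eq_differentiable (IH G CG p Op).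
by apply: near_open Op _ => q Oq; exact: foldr_pd_ext.
Qed.

Lemma smooth_on_diff (W : normedModType R) (F : R * R -> W) p :
  smooth_on Omega F -> Omega p -> differentiable F p.
Proof. by move=> sF; exact: (sF [::]). Qed.


Lemma smooth_on_cst (W : normedModType R) (c : W) : smooth_on Omega (cst c).
Proof.
apply: (@smooth_on_closed _ (fun F => exists c, F = cst c)); last by exists c.
  by move=> F p [{}c ->] _.
by move=> F i [{}c ->]; exists (cst 0) => [|p _]; [exists 0|rewrite /pd derive_cst].
Qed.

Lemma smooth_onD (W : normedModType R) (F G : R * R -> W) :
  smooth_on Omega F -> smooth_on Omega G -> smooth_on Omega (fun p => F p + G p).
Proof.
move=> sF sG.
apply: (@smooth_on_closed _ (fun X => exists F G, [/\ smooth_on Omega F,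
  smooth_on Omega G & X = (fun p => F p + G p)])); last by exists F, G.
  by move=> _ p [{sF}F [{sG}G [sF sG ->]]] Op; apply: differentiableD; exact: smooth_on_diff.
move=> _ i [{sF}F [{sG}G [sF sG ->]]]; exists (fun p => pd i F p + pd i G p).
  by exists (pd i F), (pd i G); split=> //; exact: smooth_on_pd.
by move=> p Op; rewrite /pd -deriveD//; apply: diff_derivable; exact: smooth_on_diff.
Qed.

Lemma smooth_onZ (W : normedModType R) (c : R) (F : R * R -> W) :
  smooth_on Omega F -> smooth_on Omega (fun p => c *: F p).
Proof.
move=> sF.
apply: (@smooth_on_closed _ (fun X => exists2 F, smooth_on Omega F &
  X = (fun p => c *: F p))); last by exists F.
  by move=> _ p [{sF}F sF ->] Op; apply: differentiableZ; exact: smooth_on_diff.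
move=> _ i [{sF}F sF ->]; exists (fun p => c *: pd i F p).
  by exists (pd i F) => //; exact: smooth_on_pd.
by move=> p Op; rewrite /pd -deriveZ//; apply: diff_derivable; exact: smooth_on_diff.
Qed.

Implicit Types F G : R * R -> 'M[R]_2.

Lemma pd_mulmx F G i p : differentiable F p -> differentiable G p ->
  pd i (fun q => F q *m G q) p = pd i F p *m G p + F p *m pd i G p.
Proof.
move=> dF dG; rewrite /pd.
have [_ E] := is_derive_mulmx (diff_is_derive (dir R i) dF) (diff_is_derive (dir R i) dG).
by rewrite E (deriveE _ dF) (deriveE _ dG).
Qed.

(** Products of smooth maps are not closed under partial derivatives; by the Leibniz rule their
    finite sums are. *)
Inductive sum_of_products : (R * R -> 'M[R]_2) -> Prop :=
| sum_of_products_mul F G : smooth_on Omega F -> smooth_on Omega G ->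
    sum_of_products (fun p => F p *m G p)
| sum_of_products_add F G : sum_of_products F -> sum_of_products G ->
    sum_of_products (fun p => F p + G p).

Lemma smooth_on_mulmx F G : smooth_on Omega F -> smooth_on Omega G ->
  smooth_on Omega (fun p => F p *m G p).
Proof.
move=> sF sG; apply: (@smooth_on_closed _ sum_of_products); last exact: sum_of_products_mul.
  move=> X p; elim=> [{sF}F {sG}G sF sG|{sF}F {sG}G _ dF _ dG] Op.
    by apply: differentiable_mulmx; exact: smooth_on_diff.
  by apply: differentiableD; [exact: dF|exact: dG].
(* Differentiability is carried through the induction, since the derivative of a sum splits only
   when both summands have one. *)
move=> X i sX; suff [Y sY [_ XY]] : exists2 Y, sum_of_products Y &
    (forall p, Omega p -> differentiable X p) /\ forall p, Omega p -> Y p = pd i X p.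
  by exists Y.
elim: sX => [{sF}F {sG}G sF sG|{sF}F {sG}G _ [F' sF' [dF EF]] _ [G' sG' [dG EG]]].
  exists (fun p => pd i F p *m G p + F p *m pd i G p).
    by apply: sum_of_products_add; apply: sum_of_products_mul => //; exact: smooth_on_pd.
  split=> p Op; first by apply: differentiable_mulmx; exact: smooth_on_diff.
  by rewrite pd_mulmx//; exact: smooth_on_diff.
exists (fun p => F' p + G' p); first exact: sum_of_products_add.
split=> p Op; first by apply: differentiableD; [exact: dF|exact: dG].
by rewrite EF// EG// /pd -deriveD//; apply: diff_derivable; [exact: dF|exact: dG].
Qed.

Lemma pd_entry F i p j k : differentiable F p ->
  pd i F p j k = pd i (fun q => F q j k) p.
Proof. by move=> dF; rewrite /pd derive_mx ?mxE//; exact: diff_derivable. Qed.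

(** [mixed_partials] rests on the scalar mean value theorem, so the symmetry is read off entry by
    entry. *)
Lemma smooth_on_pdC F i j p : smooth_on Omega F -> Omega p ->
  pd j (pd i F) p = pd i (pd j F) p.
Proof.
move=> sF Op; apply/matrixP => k l.
have spd m q : Omega q -> differentiable (pd m F) q.
  by move=> Oq; apply: smooth_on_diff Oq; exact: smooth_on_pd.
have dpd m n q : Omega q -> pd n (pd m F) q k l = pd n (pd m (fun q => F q k l)) q.
  move=> Oq; rewrite pd_entry//; last exact: spd.
  apply: near_eq_derive; apply: near_open Oq _ => {}q Oq.
  by rewrite pd_entry//; exact: smooth_on_diff.
have dpde m : differentiable (pd m (fun q => F q k l)) p.
  apply: (near_eq_differentiable (F := fun q => pd m F q k l)).
    apply: near_open Op _ => q Oq.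
    by rewrite pd_entry//; exact: smooth_on_diff.
  by move/differentiable_mxP: (spd m p Op).
apply: etrans (dpd i j _ Op) _; apply: etrans _ (esym (dpd j i _ Op)).
apply: (@mixed_partials _ _ (fun q => F q k l)); [|exact: dpde|exact: dpde].
apply: near_open Op _ => q Oq.
by have /differentiable_mxP := smooth_on_diff sF Oq.
Qed.

End SmoothOn.

(** * Flat connections on the plane *)

Section Adjugate.
Context {R : realType}.
Implicit Types X Y : 'M[R]_2.

Lemma mxbarE X : [/\ mxbar X 0 0 = X 1 1, mxbar X 0 1 = - X 0 1,
  mxbar X 1 0 = - X 1 0 & mxbar X 1 1 = X 0 0].
Proof.
by rewrite /mxbar tr2 !mxE /= !mulr1n !mulr0n; split; ring.
Qed.

Lemma mxbar_mulmx X Y : mxbar (X *m Y) = mxbar Y *m mxbar X.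
Proof.
have [a1 a2 a3 a4] := mxbarE X; have [b1 b2 b3 b4] := mxbarE Y.
have [c1 c2 c3 c4] := mxbarE (X *m Y).
apply/mx2P; rewrite c1 c2 c3 c4 !mulmx2E a1 a2 a3 a4 b1 b2 b3 b4.
by split; ring.
Qed.

Lemma det2 X : \det X = X 0 0 * X 1 1 - X 0 1 * X 1 0.
Proof.
apply: oppr_inj; rewrite -ip_det /ip /mxbar !tr2 !mulmx2E !mxE/= !mulr1n !mulr0n.
by field.
Qed.

(** Cayley-Hamilton in dimension two: [mxbar X] is the adjugate, hence the inverse when the
    determinant is 1. *)
Lemma mulmx_mxbar X : X *m mxbar X = (\det X)%:M.
Proof.
have [a1 a2 a3 a4] := mxbarE X.
apply/mx2P; rewrite !mulmx2E a1 a2 a3 a4 det2 !mxE/= !mulr1n !mulr0n.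
by split; ring.
Qed.

Lemma mxbar_mulmxl X : mxbar X *m X = (\det X)%:M.
Proof.
have [a1 a2 a3 a4] := mxbarE X.
apply/mx2P; rewrite !mulmx2E a1 a2 a3 a4 det2 !mxE/= !mulr1n !mulr0n.
by split; ring.
Qed.

Lemma addmx_mxbar X : X + mxbar X = (\tr X)%:M.
Proof. by rewrite /mxbar addrC subrK. Qed.

Lemma is_derive_mxbar (V : normedModType R) (F : V -> 'M[R]_2) (x v : V) dF :
  is_derive x v F dF -> is_derive x v (fun y => mxbar (F y)) (mxbar dF).
Proof.
move=> /is_derive_mxP DF; apply/is_derive_mxP.
have [b1 b2 b3 b4] := mxbarE dF.
have E i j k l s : (forall X, mxbar X i j = s * X k l) ->
    is_derive x v (fun y => mxbar (F y) i j) (mxbar dF i j).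
  move=> bs; rewrite bs; under eq_fun do rewrite bs.
  exact: (is_deriveZ s (DF k l)).
apply: ord2P; apply: ord2P.
- by apply: (E _ _ 1 1 1) => X; have [-> _ _ _] := mxbarE X; rewrite mul1r.
- by apply: (E _ _ 0 1 (-1)) => X; have [_ -> _ _] := mxbarE X; rewrite mulN1r.
- by apply: (E _ _ 1 0 (-1)) => X; have [_ _ -> _] := mxbarE X; rewrite mulN1r.
- by apply: (E _ _ 0 0 1) => X; have [_ _ _ ->] := mxbarE X; rewrite mul1r.
Qed.

(* With [A] traceless, [mxbar A = - A] cancels the derivative of [u *m mxbar v]. *)
Lemma wronskian_constant (u v A : R -> 'M[R]_2) (s t : R) : s <= t ->
  (forall x, s <= x <= t -> \tr (A x) = 0) ->
  (forall x, s <= x <= t -> is_derive x 1 u (u x *m A x)) ->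
  (forall x, s <= x <= t -> is_derive x 1 v (v x *m A x)) ->
  u t *m mxbar (v t) = u s *m mxbar (v s).
Proof.
move=> st A0 Du Dv; apply/eqP; rewrite -subr_eq0 -normr_le0.
rewrite -(mul0r (t - s)).
apply: (mx_mean_value (u := fun x => u x *m mxbar (v x)) (du := fun=> 0) st).
  move=> x xst; have D := is_derive_mulmx (Du x xst) (is_derive_mxbar (Dv x xst)).
  apply: (is_derive_eq D); rewrite mxbar_mulmx !mulmxA -mulmxDl -mulmxDr addmx_mxbar.
  by rewrite A0// raddf0 mulmx0 mul0mx.
by move=> x _; rewrite normr0.
Qed.

(** Liouville's formula for a traceless coefficient: in [wronskian_constant] with v = u the constant
    is the determinant. *)
Lemma linear_ode_det (u A : R -> 'M[R]_2) (t0 d : R) :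
  (forall x, `|x - t0| <= d -> \tr (A x) = 0) ->
  (forall x, `|x - t0| <= d -> is_derive x 1 u (u x *m A x)) ->
  \det (u t0) = 1 -> forall t, `|t - t0| <= d -> \det (u t) = 1.
Proof.
move=> A0 Du d1 t td.
suff /matrixP/(_ 0 0) : (\det (u t))%:M = (\det (u t0))%:M :> 'M[R]_2.
  by rewrite !mxE/= !mulr1n => ->.
rewrite -!mulmx_mxbar; case/orP: (le_total t0 t) => tt0; last apply/esym;
  apply: (wronskian_constant (A := A)) => // x /andP[x1 x2];
  (apply: A0 || apply: Du); move: td => /ler_normlP[? ?]; apply/ler_normlP; split; lra.
Qed.

Lemma det1_mulmx_inj (X Y Z : 'M[R]_2) : \det Z = 1 ->
  X *m mxbar Z = Y *m mxbar Z -> X = Y.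
Proof.
move=> Z1 /(congr1 (mulmx^~ Z)); rewrite -!mulmxA mxbar_mulmxl Z1.
by rewrite !mulmx1.
Qed.

End Adjugate.

Section Connection.
Context {R : realType} (A B : R * R -> 'M[R]_2).
Implicit Types (F G : R * R -> 'M[R]_2) (p q : R * R).

(** The equation F^-1 dF = A dx + B dy written without an inverse. The determinant condition
    supplies the invertibility with which frames are cancelled later. *)
Definition parallel F q := [/\ differentiable F q,
  forall v, 'd F q v = F q *m (v.1 *: A q + v.2 *: B q) & \det (F q) = 1].

Lemma parallel_mull C F q : \det C = 1 -> parallel F q ->
  parallel (fun p => C *m F p) q.
Proof.
move=> C1 [dF EF F1].
have dC : differentiable (fun=> C : 'M[R]_2) q by exact: differentiable_cst.
split; first exact: differentiable_mulmx.
  move=> v; apply: etrans (diff_mulmx v dC dF) _.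
  have z : 'd (fun=> C : 'M[R]_2) q v = 0 by exact: (congr1 (@^~ v) (diff_cst C q)).
  apply: etrans (congr2 (fun X Y => X *m F q + C *m Y) z (EF v)) _.
  by rewrite mul0mx add0r mulmxA.
by rewrite det_mulmx C1 F1 mulr1.
Qed.

Lemma near_eq_parallel F G q :
  (\forall p \near q, F p = G p) -> parallel F q -> parallel G q.
Proof.
move=> FG [dF EF F1]; have E := nbhs_singleton FG.
have dG := near_eq_differentiable FG dF.
split; [exact: dG| |by rewrite -E].
move=> v; rewrite -E; apply: etrans _ (EF v).
apply: etrans (esym (deriveE v dG)) (etrans _ (deriveE v dF)).
exact/esym/near_eq_derive.
Qed.

Lemma ball_line (p a b : R * R) (r t : R) : ball p r a -> ball p r b ->
  0 <= t <= 1 -> ball p r (t *: (b - a) + a).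
Proof.
rewrite -!ball_normE /= => pa pb /andP[t0 t1].
have -> : p - (t *: (b - a) + a) = (1 - t) *: (p - a) + t *: (p - b).
  rewrite !scalerBr !scalerBl !scale1r; apply/eqP; rewrite -subr_eq0; apply/eqP.
  by apply/eqP; rewrite /=; case: p a b {pa pb} => [p1 p2] [a1 a2] [b1 b2];
     apply/eqP; congr (_, _); rewrite /GRing.scale/=; ring.
rewrite (le_lt_trans (ler_normD _ _))// !normrZ ger0_norm ?subr_ge0// ger0_norm//.
(* For t > 0 strictness comes from the endpoint b; at t = 0 it has to come from a. *)
have [->|tn0] := eqVneq t 0; first by rewrite mul0r addr0 subr0 mul1r.
have : t * `|p - b| < t * r by rewrite ltr_pM2l// lt_neqAle eq_sym tn0.
have : (1 - t) * `|p - a| <= (1 - t) * r by rewrite ler_wpM2l ?subr_ge0// ltW.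
by lra.
Qed.

(** Along the segment from a to b both frames solve u' = u M with the same traceless M, so
    [wronskian_constant] compares F with G at the two ends. *)
Lemma parallel_unique F G p r a b :
  (forall q, ball p r q -> \tr (A q) = 0 /\ \tr (B q) = 0) ->
  (forall q, ball p r q -> parallel F q) ->
  (forall q, ball p r q -> parallel G q) ->
  ball p r a -> ball p r b -> F a = G a -> F b = G b.
Proof.
move=> tr0 sF sG pa pb FGa.
pose l (t : R) := t *: (b - a) + a.
have bl t : 0 <= t <= 1 -> ball p r (l t) by exact: ball_line.
have l0 : l 0 = a by rewrite /l scale0r add0r.
have l1 : l 1 = b by rewrite /l scale1r subrK.
pose M (t : R) : 'M[R]_2 := (b - a).1 *: A (l t) + (b - a).2 *: B (l t).
have D H : (forall q, ball p r q -> parallel H q) ->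
    forall t : R, 0 <= t <= 1 -> is_derive t 1 (H \o l) ((H \o l) t *m M t).
  move=> sH t t01; have [dH EH _] := sH _ (bl t t01).
  exact: is_derive_eq (is_derive_line dH) (EH _).
have tM t : 0 <= t <= 1 -> \tr (M t) = 0.
  move=> t01; have [trA trB] := tr0 _ (bl t t01).
  by rewrite /M linearD/= !linearZ/= trA trB !mulr0 addr0.
have := wronskian_constant ler01 tM (D F sF) (D G sG).
rewrite /= l0 l1 FGa mulmx_mxbar => W.
have [_ _ Ga1] := sG _ pa; have [_ _ Gb1] := sG _ pb.
by apply: (det1_mulmx_inj Gb1); rewrite W mulmx_mxbar Gb1 Ga1.
Qed.

End Connection.

Section Partials.
Context {R : realType} {W : normedModType R}.
Implicit Types F : R * R -> W.

Lemma is_derive_dx F (x y : R) : differentiable F (x, y) ->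
  is_derive x 1 (fun t => F (t, y)) (dx F (x, y)).
Proof.
have E t : t *: ((1, 0) : R * R) + (0, y) = (t, y).
  by congr (_, _); rewrite /= /GRing.scale/= ?mulr1 ?mulr0 ?addr0 ?add0r.
move=> dF; have /is_derive_line D : differentiable F (x *: ((1, 0) : R * R) + (0, y)).
  by rewrite E.
have F1 : (fun t => F (t, y)) = (fun t => F (t *: ((1, 0) : R * R) + (0, y))).
  by apply/funext => t; rewrite E.
rewrite F1; apply: is_derive_eq D _; rewrite E.
exact: esym (deriveE ((1, 0) : R * R) dF).
Qed.

Lemma is_derive_dy F (x y : R) : differentiable F (x, y) ->
  is_derive y 1 (fun t => F (x, t)) (dy F (x, y)).
Proof.
have E t : t *: ((0, 1) : R * R) + (x, 0) = (x, t).
  by congr (_, _); rewrite /= /GRing.scale/= ?mulr1 ?mulr0 ?addr0 ?add0r.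
move=> dF; have /is_derive_line D : differentiable F (y *: ((0, 1) : R * R) + (x, 0)).
  by rewrite E.
have F1 : (fun t => F (x, t)) = (fun t => F (t *: ((0, 1) : R * R) + (x, 0))).
  by apply/funext => t; rewrite E.
rewrite F1; apply: is_derive_eq D _; rewrite E.
exact: esym (deriveE ((0, 1) : R * R) dF).
Qed.

End Partials.

(** * Integration of a flat connection on a small square *)

Section LocalIntegration.
Context {R : realType}.

Lemma linear_ode_segment (C : R -> 'M[R]_2) (t0 d K : R) : 0 <= d ->
  (forall t, `|t - t0| <= d -> {for t, continuous C}) ->
  (forall t, `|t - t0| <= d -> `|C t| <= K) -> 4 * K * d <= 1 ->
  exists u : R -> 'M[R]_2, u t0 = 1%:M /\
    forall t, `|t - t0| < d -> is_derive t 1 u (u t *m C t).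
Proof.
move=> d0 cC CK Kd.
have [||u [u0 Du]] := @linear_ode R (C \o clamp t0 d) t0 d K d0 _ _ Kd.
- move=> t; apply: continuous_comp; first exact: clamp_continuous.
  exact/cC/clamp_dist.
- by move=> t; apply/CK/clamp_dist.
exists u; split=> // t td; have := Du t td.
by rewrite /= clamp_id// ltW.
Qed.

(** [gronwall_short] with zero forcing and the constant 2 K, whose 2 comes from [mx_norm_mul]; its
    smallness condition becomes 4 K d <= 1. *)
Lemma linear_ode_bound (u C : R -> 'M[R]_2) (t0 d K : R) :
  (forall t, `|t - t0| <= d -> is_derive t 1 u (u t *m C t)) ->
  (forall t, `|t - t0| <= d -> `|C t| <= K) -> 4 * K * d <= 1 -> 0 <= K ->
  `|u t0| <= 1 -> forall t, `|t - t0| <= d -> `|u t| <= 2.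
Proof.
move=> Du CK Kd K0 u0 t td.
have := @gronwall_short R u (fun t => u t *m C t) t0 d (2 * K) 0 t Du _ _ _ td.
rewrite mulr0 addr0 => h.
suff : `|u t| <= 2 * `|u t0| by lra.
apply: h; [move=> s sd|lra|lra].
rewrite addr0 (le_trans (mx_norm_mul _ _))//.
have := CK _ sd; have := normr_ge0 (u s); nra.
Qed.

Lemma is_derive_scale (M : 'M[R]_2) (x s : R) :
  is_derive s 1 (fun t => (t - x) *: M) M.
Proof.
apply/is_derive_mxP => i j.
have -> : (fun t => ((t - x) *: M) i j) = M i j \*: (id - cst x).
  by apply/funext => t; rewrite mxE mulrC.
have D := is_deriveZ (M i j) (is_deriveB (is_derive_id s (1 : R)) (is_derive_cst x s (1 : R))).
by apply: is_derive_eq D _; rewrite subr0 /GRing.scale/= mulr1.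
Qed.

Lemma is_derive_eps (u : R -> 'M[R]_2) (t : R) du : is_derive t 1 u du ->
  forall e, 0 < e -> \forall h \near 0, `|u (t + h) - u t - h *: du| <= e * `|h|.
Proof.
move=> [/derivable1_diffP dU E] e e0; have := differentiable_eps dU e0.
have E' h : 'd u t h = h *: du.
  apply: etrans (_ : h *: 'd u t 1 = _).
    by rewrite -linearZ/=; congr ('d u t _); rewrite /GRing.scale/= mulr1.
  by congr (_ *: _); rewrite -E; apply/esym/deriveE.
by apply: filterS => h; rewrite (addrC h t); move: (E' h) => /= ->.
Qed.

Lemma addmx2E (X Y : 'M[R]_2) i j : (X + Y) i j = X i j + Y i j.
Proof. by rewrite mxE. Qed.

Lemma oppmx2E (X : 'M[R]_2) i j : (- X) i j = - X i j.
Proof. by rewrite mxE. Qed.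

Lemma scalemx2E (c : R) (X : 'M[R]_2) i j : (c *: X) i j = c * X i j.
Proof. by rewrite mxE. Qed.

(** Primes denote values at x + h, with M = A, N = B, dM = A_y and dN = B_x. The left side is the
    y-derivative of the defect F' - F (1 + h M). The right side is linear in the defect, plus a
    forcing that is quadratic in h: a Taylor remainder of N and h times an increment of N. *)
Lemma flatness_identity (F F' M N N' dM dN : 'M[R]_2) (h : R) :
  dM - dN = M *m N - N *m M ->
  F' *m N' - (F *m N *m (1%:M + h *: M) + F *m (h *: dM)) =
  (F' - F *m (1%:M + h *: M)) *m N'
  + F *m (N' - N - h *: dN + h *: (M *m (N' - N))).
Proof.
move=> /eqP; rewrite subr_eq => /eqP ->.
rewrite !(mulmxDl, mulmxDr, mulmxN, mulNmx, mulmx1, scalerDr, scalerN).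
rewrite -?(scalemxAl, scalemxAr) !mulmxA.
by apply/matrixP => i j; rewrite !(addmx2E, oppmx2E, scalemx2E); ring.
Qed.

Lemma near0_lt (e : R) : 0 < e -> \forall h \near (0 : R), `|h| < e.
Proof.
move=> e0; apply/nbhs_ballP; exists e => //= h.
by rewrite -ball_normE/= sub0r normrN.
Qed.

Lemma shift_dist (a h a0 d : R) : `|h| < d - `|a - a0| ->
  `|a + h - a0| <= d /\ `|a - a0| + `|h| <= d.
Proof.
move=> hd; have := ler_normD (a - a0) h; rewrite addrAC => h3.
by split; lra.
Qed.

Lemma near_fst (P : R -> Prop) : (\forall t \near 0, P t) ->
  \forall h \near (0 : R * R), P h.1.
Proof. exact: (@cvg_fst R R (nbhs 0) (nbhs 0) _). Qed.

Lemma near_snd (P : R -> Prop) : (\forall t \near 0, P t) ->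
  \forall h \near (0 : R * R), P h.2.
Proof. exact: (@cvg_snd R R (nbhs 0) (nbhs 0) _). Qed.

Lemma is_diff_partials (F : R * R -> 'M[R]_2) (q : R * R) (M N : 'M[R]_2) :
  (forall e, 0 < e -> \forall h \near (0 : R * R),
    `|F (h + q) - F q - (h.1 *: M + h.2 *: N)| <= e * `|h|) ->
  differentiable F q /\ forall v, 'd F q v = v.1 *: M + v.2 *: N.
Proof.
move=> FL; pose L (v : R * R) := v.1 *: M + v.2 *: N.
have linL : linear L.
  move=> c v w; rewrite /L/= scalerDr !scalerA !scalerDl.
  by rewrite addrACA.
pose dLM := GRing.isLinear.Build _ _ _ _ L linL.
pose dL : {linear (R * R)%type -> 'M[R]_2} := HB.pack L dLM.
have cL : continuous L.
  move=> v; apply: cvgD; apply: cvgZl; [exact: cvg_fst|exact: cvg_snd].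
have [dF EF] := @eps_is_diff _ _ _ F q dL cL FL.
by split=> // v; apply: (congr1 (@^~ v) EF).
Qed.

Lemma small_radius (K r : R) : 0 <= K -> 0 < r -> 8 * K * r <= 1 ->
  4 * K * r <= 1 /\ 4 * K * (r / 2) <= 1.
Proof. by move=> K0 /ltW r0 Kr; have := mulr_ge0 K0 r0; split; lra. Qed.

Variables (A B : R * R -> 'M[R]_2) (x0 y0 r K : R).
Let box (q : R * R) := `|q.1 - x0| <= r /\ `|q.2 - y0| <= r.
Hypotheses (r0 : 0 < r) (K0 : 0 <= K) (Kr : 8 * K * r <= 1).
Hypothesis dA : forall q, box q -> differentiable A q.
Hypothesis dB : forall q, box q -> differentiable B q.
Hypothesis dBx : forall q, box q -> differentiable (dx B) q.
Hypothesis AK : forall q, box q -> `|A q| <= K.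
Hypothesis BK : forall q, box q -> `|B q| <= K.
Hypothesis BxK : forall q, box q -> `|dx B q| <= K.
Hypothesis BxxK : forall q, box q -> `|dx (dx B) q| <= K.
Hypothesis tr0 : forall q, box q -> \tr (A q) = 0 /\ \tr (B q) = 0.
Hypothesis flat : forall q, box q -> dy A q - dx B q = A q *m B q - B q *m A q.

Lemma dx_lipschitz x h y : box (x, y) -> box (x + h, y) ->
  `|B (x + h, y) - B (x, y)| <= K * `|h|.
Proof.
move=> [/= hx hy] [/= hxh _].
have xhx : x + h - x = h by rewrite addrC addKr.
have := mx_mean_value_dist (u := fun t => B (t, y)) (du := fun t => dx B (t, y))
  (t0 := x0) (d := r) (C := K) _ _ hx hxh.
have bx t : `|t - x0| <= r -> box (t, y) by [].
rewrite xhx; apply => t /bx; last exact: BxK.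
by move=> /dB /is_derive_dx.
Qed.

(** Two mean value bounds: the remainder [w] vanishes at x and has derivative B_x(s, y) - B_x(x, y),
    itself at most K |h| by the bound on B_xx. *)
Lemma dx_taylor x h y : `|x - x0| + `|h| <= r -> `|y - y0| <= r ->
  `|B (x + h, y) - B (x, y) - h *: dx B (x, y)| <= K * `|h| ^+ 2.
Proof.
move=> xh hy.
have bx s : `|s - x| <= `|h| -> box (s, y).
  move=> sx; split=> //=.
  by have := ler_normD (s - x) (x - x0); rewrite subrKA; lra.
have bxx : box (x, y) by apply: bx; rewrite subrr normr0.
pose w s := B (s, y) - B (x, y) - (s - x) *: dx B (x, y).
have Dw s : `|s - x| <= `|h| -> is_derive s 1 w (dx B (s, y) - dx B (x, y)).
  move=> sx; have D := is_deriveB (is_deriveB (is_derive_dx (dB (bx s sx)))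
    (is_derive_cst (B (x, y)) s (1 : R))) (is_derive_scale (dx B (x, y)) x s).
  by apply: is_derive_eq D _; rewrite subr0.
have wd s : `|s - x| <= `|h| -> `|dx B (s, y) - dx B (x, y)| <= K * `|h|.
  move=> sx.
  have xx : `|x - x| <= `|h| by rewrite subrr normr0.
  apply: (le_trans (mx_mean_value_dist (u := fun t => dx B (t, y))
    (du := fun t => dx (dx B) (t, y)) (C := K) _ _ xx sx)) => [t tx|t tx|].
  - exact: is_derive_dx (dBx (bx t tx)).
  - exact: BxxK (bx t tx).
  - by rewrite ler_wpM2l.
have xhx : x + h - x = h by rewrite addrC addKr.
have xx : `|x - x| <= `|h| by rewrite subrr normr0.
have xh' : `|x + h - x| <= `|h| by rewrite xhx.
have := mx_mean_value_dist Dw wd xx xh'.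
by rewrite /w !subrr scale0r !subr0 expr2 mulrA xhx.
Qed.

Lemma parallel_box : exists F : R * R -> 'M[R]_2, F (x0, y0) = 1%:M /\
  forall q, ball (x0, y0) (r / 2) q -> parallel A B F q.
Proof.
move: (r0) (K0) => r0' K0'.
have sbox x y : `|x - x0| <= r -> `|y - y0| <= r -> box (x, y) by [].
have rr0 : `|x0 - x0| <= r by rewrite subrr normr0 ltW.
have rr1 : `|y0 - y0| <= r by rewrite subrr normr0 ltW.
have Kr4 : 4 * K * r <= 1.
  by have [] := small_radius K0 r0 Kr.
have [U [U0 DU]] : exists u : R -> 'M[R]_2, u x0 = 1%:M /\
    forall t, `|t - x0| < r -> is_derive t 1 u (u t *m A (t, y0)).
  apply: (@linear_ode_segment (fun t => A (t, y0)) x0 r K) => // [|t tr|t tr].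
  - exact: ltW.
  - exact: is_derive_continuous (is_derive_dx (dA (sbox t y0 tr rr1))).
  - exact: AK.
have exV x : exists v : R -> 'M[R]_2, `|x - x0| <= r -> v y0 = 1%:M /\
    forall t, `|t - y0| < r -> is_derive t 1 v (v t *m B (x, t)).
  have [xr|xr] := pselect (`|x - x0| <= r); last by exists (cst 0).
  have [|t tr|t tr|v hv] := @linear_ode_segment (fun t => B (x, t)) y0 r K _ _ _ Kr4.
  - exact: ltW.
  - exact: is_derive_continuous (is_derive_dy (dB (sbox x t xr tr))).
  - exact: BK.
  by exists v.
have [V hV] := choice exV.
have V0 x : `|x - x0| <= r -> V x y0 = 1%:M by move=> /hV[].
have DV x t : `|x - x0| <= r -> `|t - y0| < r ->
    is_derive t 1 (V x) (V x t *m B (x, t)) by move=> /hV[_]; exact.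
pose F q := U q.1 *m V q.1 q.2.
(* The solutions are differentiable on open intervals of radius r; halving the radius leaves closed
   intervals on which [gronwall_short] applies. *)
pose d := r / 2.
have d0 : 0 < d by rewrite divr_gt0.
have dr (t t1 : R) : `|t - t1| <= d -> `|t - t1| < r by move/le_lt_trans; apply; rewrite /d; lra.
have dr' (t t1 : R) : `|t - t1| <= d -> `|t - t1| <= r by move/dr/ltW.
have Kd4 : 4 * K * d <= 1.
  by have [] := small_radius K0 r0 Kr.
have UK t : `|t - x0| <= d -> `|U t| <= 2.
  apply: (linear_ode_bound (C := fun t => A (t, y0)) _ _ Kd4) => // [s sd|s sd|].
  - exact/DU/dr.
  - by apply: AK; apply: sbox => //; exact: dr'.
  - by rewrite U0 mx_norm1_le.
have VK x t : `|x - x0| <= d -> `|t - y0| <= d -> `|V x t| <= 2.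
  move=> xd; apply: (linear_ode_bound (C := fun t => B (x, t)) _ _ Kd4) => // [s sd|s sd|].
  - by apply: DV; [exact: dr'|exact: dr].
  - by apply: BK; apply: sbox; exact: dr'.
  - by rewrite V0 ?mx_norm1_le//; exact: dr'.
(* 8 is 2 * 2 * 2: the two factors are bounded by 2, and [mx_norm_mul] contributes another 2. *)
have FK x y : `|x - x0| <= d -> `|y - y0| <= d -> `|F (x, y)| <= 8.
  move=> xd yd; rewrite (le_trans (mx_norm_mul_le (UK x xd) (VK x y xd yd)))//.
  lra.
have F0 : F (x0, y0) = 1%:M by rewrite /F/= U0 V0// mulmx1.
have Fdet x y : `|x - x0| <= d -> `|y - y0| <= d -> \det (F (x, y)) = 1.
  move=> xd yd; rewrite det_mulmx.
  have -> : \det (U x) = 1.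
    apply: (linear_ode_det (A := fun t => A (t, y0)) (t0 := x0) (d := d)) => // [s sd|s sd|].
    - by have [] := tr0 (sbox s y0 (dr' _ _ sd) rr1).
    - exact/DU/dr.
    - by rewrite U0 det1.
  rewrite mul1r.
  apply: (linear_ode_det (A := fun t => B (x, t)) (t0 := y0) (d := d)) => // [s sd|s sd|].
  - by have [] := tr0 (sbox x s (dr' _ _ xd) (dr' _ _ sd)).
  - by apply: DV; [exact: dr'|exact: dr].
  - by rewrite V0 ?det1//; exact: dr'.
have DFy x y : `|x - x0| <= d -> `|y - y0| <= d ->
    is_derive y 1 (fun t => F (x, t)) (F (x, y) *m B (x, y)).
  move=> xd yd; have DVx := DV x y (dr' _ _ xd) (dr _ _ yd).
  have D := is_derive_mulmx (is_derive_cst (U x) y (1 : R)) DVx.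
  apply: is_derive_eq D _; by rewrite mul0mx add0r mulmxA.
pose e x h y := F (x + h, y) - F (x, y) *m (1%:M + h *: A (x, y)).
(* The forcing is F times a matrix of norm at most (K + 2 K^2) h^2; with |F| <= 8 and the factor 2
   of [mx_norm_mul] this gives 16. *)
pose C := 16 * (K + 2 * K ^+ 2).
have eK x h y : `|x - x0| < d -> `|x + h - x0| <= d -> `|x - x0| + `|h| <= r ->
     `|y - y0| <= d -> `|e x h y| <= 2 * (`|e x h y0| + d * (C * `|h| ^+ 2)).
  move=> /ltW xd xhd xhr.
  pose de y := F (x + h, y) *m B (x + h, y) - (F (x, y) *m B (x, y) *m (1%:M + h *: A (x, y))
     + F (x, y) *m (h *: dy A (x, y))).
  have De t : `|t - y0| <= d -> is_derive t 1 (e x h) (de t).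
    move=> td.
    have DA := is_derive_dy (dA (sbox x t (dr' _ _ xd) (dr' _ _ td))).
    have D := is_deriveB (DFy (x + h) t xhd td) (is_derive_mulmx (DFy x t xd td)
      (is_deriveD (is_derive_cst (1%:M : 'M[R]_2) t (1 : R)) (is_deriveZ h DA))).
    by apply: is_derive_eq D _; rewrite add0r.
  apply: (gronwall_short (du := de) (K := 2 * K) De).
  - move=> t td; have bxt : box (x, t) by apply: sbox; exact: dr'.
    have bxht : box (x + h, t) by apply: sbox; exact: dr'.
    pose rho := B (x + h, t) - B (x, t) - h *: dx B (x, t).
    have -> : de t = e x h t *m B (x + h, t) + F (x, t) *m
       (rho + h *: (A (x, t) *m (B (x + h, t) - B (x, t)))).
      exact/flatness_identity/flat.
    have rhoK : `|rho| <= K * `|h| ^+ 2 by apply: dx_taylor => //; exact: dr'.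
    have hK : `|h *: (A (x, t) *m (B (x + h, t) - B (x, t)))| <= 2 * K ^+ 2 * `|h| ^+ 2.
      rewrite normrZ; have := mx_norm_mul_le (AK bxt) (dx_lipschitz bxt bxht).
      move=> /(ler_wpM2l (normr_ge0 h)) /le_trans; apply.
      by rewrite le_eqVlt; apply/orP; left; apply/eqP; ring.
    rewrite (le_trans (ler_normD _ _))// lerD//.
      rewrite (le_trans (mx_norm_mul_le (lexx _) (BK bxht)))//.
      by rewrite le_eqVlt; apply/orP; left; apply/eqP; ring.
    rewrite (le_trans (mx_norm_mul_le (FK x t xd td) (le_trans (ler_normD _ _) (lerD rhoK hK))))//.
    by rewrite /C le_eqVlt; apply/orP; left; apply/eqP; ring.
  - by rewrite mulr_ge0.
  - lra.
exists F; split=> // -[x y]; rewrite /ball/= /prod_ball/= -!ball_normE/= => -[xd yd].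
move: xd yd; rewrite distrC -/d => xd; rewrite distrC -/d => yd.
have xd' := ltW xd; have yd' := ltW yd.
suff [dF EF] : differentiable F (x, y) /\ forall v, 'd F (x, y) v =
    v.1 *: (F (x, y) *m A (x, y)) + v.2 *: (F (x, y) *m B (x, y)).
  split=> //; last exact: Fdet.
  by move=> v; rewrite mulmxDr -!scalemxAr; exact: EF.
apply: is_diff_partials => ep ep0.
have C0 : 0 <= C by rewrite /C mulr_ge0// addr_ge0// mulr_ge0// exprn_ge0.
(* Error budget: the initial defect costs ep/8 doubled by Gronwall, the quadratic forcing ep/4, the
   vertical increment ep/8 and the variation of F A with height ep/4, in all 7/8 ep. *)
have ep8 : 0 < ep / 8 by rewrite divr_gt0.
have nearU := near_fst (is_derive_eps (DU x (dr _ _ xd')) ep8).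
have nearF := near_snd (is_derive_eps (DFy x y xd' yd') ep8).
have nearx : \forall h \near (0 : R), [/\ `|x + h - x0| <= d, `|x - x0| + `|h| <= r
    & 2 * d * C * `|h| <= ep / 4].
  have D0 : 0 < 2 * d * C + 1.
    exact: ltr_wpDl (mulr_ge0 (mulr_ge0 (ler0n R 2) (ltW d0)) C0) ltr01.
  near=> h.
  have h1 : `|h| < d - `|x - x0| by near: h; apply: near0_lt; rewrite subr_gt0.
  have h2 : `|h| < ep / 4 / (2 * d * C + 1).
    by near: h; apply: near0_lt; apply: divr_gt0 => //; exact: divr_gt0.
  have [h3 h4] := shift_dist h1.
  split=> //; first by apply: (le_trans h4); rewrite /d ler_pdivrMr// ler_peMr// ?ler1n// ltW.
  rewrite mulrC; move: h2; rewrite ltr_pdivlMr// => /ltW; apply: le_trans.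
  by rewrite ler_wpM2l// lerDl.
have neary : \forall h \near (0 : R), `|y + h - y0| <= d /\
   `|F (x, y + h) *m A (x, y + h) - F (x, y) *m A (x, y)| <= ep / 4.
  have DA := is_derive_dy (dA (sbox x y (dr' _ _ xd') (dr' _ _ yd'))).
  have /cvgrPdist_le := is_derive_continuous (is_derive_mulmx (DFy x y xd' yd') DA).
  move=> /(_ (ep / 4) (divr_gt0 ep0 (ltr0n R 4))) /nbhs0P nG.
  near=> h.
  have h1 : `|h| < d - `|y - y0| by near: h; apply: near0_lt; rewrite subr_gt0.
  have [h3 _] := shift_dist h1.
  split; [exact: h3|rewrite distrC].
  by near: h.
have nearx2 := near_fst nearx; have neary2 := near_snd neary.
near=> h.
have hU : `|U (x + h.1) - U x - h.1 *: (U x *m A (x, y0))| <= ep / 8 * `|h.1|.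
  by near: h.
have hF : `|F (x, y + h.2) - F (x, y) - h.2 *: (F (x, y) *m B (x, y))| <= ep / 8 * `|h.2|.
  by near: h.
have [xh1 xh2 xh3] : [/\ `|x + h.1 - x0| <= d, `|x - x0| + `|h.1| <= r
    & 2 * d * C * `|h.1| <= ep / 4] by near: h.
have [yh1 yh2] : `|y + h.2 - y0| <= d /\
  `|F (x, y + h.2) *m A (x, y + h.2) - F (x, y) *m A (x, y)| <= ep / 4 by near: h.
have [n1 n2] : `|h.1| <= `|h| /\ `|h.2| <= `|h|.
  by rewrite prod_normE !le_max !lexx orbT.
(* On the base line V is the identity, so the defect is the first-order remainder of U alone. *)
have E0 : e x h.1 y0 = U (x + h.1) - U x - h.1 *: (U x *m A (x, y0)).
  rewrite /e /F/= !V0//; [|exact: dr'..].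
  by rewrite !mulmx1 mulmxDr mulmx1 -scalemxAr opprD addrA.
have := eK x h.1 (y + h.2) xd xh1 xh2 yh1; rewrite E0 => hE.
have -> : h + (x, y) = (x + h.1, y + h.2) by congr (_, _); rewrite /= addrC.
(* The increment goes up from (x, y) to (x, y + h.2) and then across at that height. The crossing is
   the defect there, plus h.1 times F A at the new height, which is compared with F A at (x, y). *)
have -> : F (x + h.1, y + h.2) - F (x, y)
    - (h.1 *: (F (x, y) *m A (x, y)) + h.2 *: (F (x, y) *m B (x, y))) =
  e x h.1 (y + h.2) + (F (x, y + h.2) - F (x, y) - h.2 *: (F (x, y) *m B (x, y)))
  + h.1 *: (F (x, y + h.2) *m A (x, y + h.2) - F (x, y) *m A (x, y)).
  rewrite /e mulmxDr mulmx1 -scalemxAr scalerBr.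
  move: (F _) (F _) (F _) (_ *: _) (_ *: _) (_ *: _) => a b c X Y Z.
  by apply/matrixP => i j; rewrite !(addmx2E, oppmx2E); ring.
have T3 : `|h.1 *: (F (x, y + h.2) *m A (x, y + h.2) - F (x, y) *m A (x, y))|
    <= `|h.1| * (ep / 4) by rewrite normrZ ler_wpM2l.
have T4 : 2 * d * C * `|h.1| ^+ 2 <= ep / 4 * `|h.1|.
  by rewrite expr2 mulrA ler_wpM2r.
have ep1 : ep * `|h.1| <= ep * `|h| by rewrite ler_pM2l.
have ep2 : ep * `|h.2| <= ep * `|h| by rewrite ler_pM2l.
rewrite (le_trans (ler_normD _ _))//.
rewrite (le_trans (lerD (le_trans (ler_normD _ _) (lerD hE hF)) T3))//.
have := mulr_ge0 (ltW ep0) (normr_ge0 h).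
by lra.
Unshelve. all: by end_near. Qed.

End LocalIntegration.

Section FlatConnection.
Context {R : realType} (Omega : set (R * R)) (A B : R * R -> 'M[R]_2).

Definition flat_sl2 :=
  [/\ open Omega, smooth_on Omega A, smooth_on Omega B,
    forall q, Omega q -> \tr (A q) = 0 /\ \tr (B q) = 0 &
    forall q, Omega q -> dy A q - dx B q = A q *m B q - B q *m A q].

Hypothesis AB : flat_sl2.

Lemma near_bound (F : R * R -> 'M[R]_2) p : differentiable F p ->
  \forall q \near p, `|F q| <= `|F p| + 1.
Proof.
by move=> /differentiable_continuous /cvgr_norm_le; apply; rewrite ltrDl.
Qed.

Lemma le_sum4 (a b c d : R) : 0 <= a -> 0 <= b -> 0 <= c -> 0 <= d ->
  [/\ a <= a + b + c + d, b <= a + b + c + d, c <= a + b + c + d & d <= a + b + c + d].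
Proof. by move=> *; split; lra. Qed.

(** The radius is fixed before the initial value C: one solution with value 1 at p is multiplied on
    the left by C. *)
Lemma local_parallel p : Omega p -> exists2 r, 0 < r & ball p r `<=` Omega /\
  forall C : 'M[R]_2, \det C = 1 -> exists F, F p = C /\
    forall q, ball p r q -> parallel A B F q.
Proof.
case: AB => oO sA sB tr0 flat Op.
have sBx : smooth_on Omega (dx B) by exact: smooth_on_pd.
have sBxx : smooth_on Omega (dx (dx B)) by exact: smooth_on_pd.
pose K := (`|A p| + 1) + (`|B p| + 1) + (`|dx B p| + 1) + (`|dx (dx B) p| + 1).
have K0 : 0 <= K by rewrite !addr_ge0.
have [KA KB KBx KBxx] : [/\ `|A p| + 1 <= K, `|B p| + 1 <= K, `|dx B p| + 1 <= K
    & `|dx (dx B) p| + 1 <= K] by apply: le_sum4; rewrite addr_ge0.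
have nA := near_bound (smooth_on_diff sA Op).
have nB := near_bound (smooth_on_diff sB Op).
have nBx := near_bound (smooth_on_diff sBx Op).
have nBxx := near_bound (smooth_on_diff sBxx Op).
have : \forall q \near p, [/\ Omega q, `|A q| <= K, `|B q| <= K, `|dx B q| <= K &
    `|dx (dx B) q| <= K].
  have nO : \forall q \near p, Omega q by exact: open_nbhs_nbhs.
  apply: filterS (filterI nO (filterI (filterI nA nB) (filterI nBx nBxx))).
  move=> q [Oq [[bA bB] [bBx bBxx]]].
  split; [exact: Oq|exact: le_trans bA KA|exact: le_trans bB KB|
    exact: le_trans bBx KBx|exact: le_trans bBxx KBxx].
move=> /nbhs_ballP[r1 /= r10 hr1].
(* The first entry keeps the closed square where the bounds by K hold; the second ensures 8 K r <=
   1. *)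
pose r := Num.min (r1 / 2) (8 * (K + 1))^-1.
have K1 : 0 < K + 1 by rewrite ltr_wpDl.
have r0 : 0 < r by rewrite lt_min divr_gt0//= invr_gt0 mulr_gt0.
have rr1 : r < r1 by rewrite gt_min ltr_pdivrMr// ltr_pMr// ltr1n.
have Kr : 8 * K * r <= 1.
  apply: (@le_trans _ _ (8 * (K + 1) * (8 * (K + 1))^-1)); last first.
    by rewrite divff// gt_eqF// mulr_gt0.
  apply: ler_pM; [by rewrite mulr_ge0|exact: ltW| |by rewrite ge_min lexx orbT].
  by rewrite ler_pM2l// lerDl.
have hb q : `|q.1 - p.1| <= r /\ `|q.2 - p.2| <= r ->
    [/\ Omega q, `|A q| <= K, `|B q| <= K, `|dx B q| <= K & `|dx (dx B) q| <= K].
  move=> [h1 h2]; apply: hr1; split; rewrite -ball_normE/= distrC.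
    exact: le_lt_trans rr1.
  exact: le_lt_trans rr1.
have [|||||||||F [F0 pF]] := @parallel_box R A B p.1 p.2 r K r0 K0 Kr.
1-9: move=> q /hb[Oq bA bB bBx bBxx] //.
- exact: smooth_on_diff sA Oq.
- exact: smooth_on_diff sB Oq.
- exact: smooth_on_diff sBx Oq.
- exact: tr0.
- exact: flat.
rewrite -surjective_pairing in F0 pF.
exists (r / 2); first by rewrite divr_gt0.
split=> [q qb|C C1].
  have [] // := hb q; move: qb => [/=]; rewrite -!ball_normE/= => h1 h2.
  have r2 : r / 2 <= r by rewrite ler_pdivrMr// ler_peMr// ?ler1n// ltW.
  by split; rewrite distrC ltW// (lt_le_trans _ r2).
exists (fun q => C *m F q); split; first by rewrite F0 mulmx1.
by move=> q qb; apply: parallel_mull => //; exact: pF.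
Qed.

End FlatConnection.

(** * Lifting along paths and homotopies *)

Lemma within_continuous_cvg (T U : topologicalType) (Q : set T) (f : T -> U) q (P : set U) :
  {within Q, continuous f} -> Q q -> nbhs (f q) P ->
  \forall q' \near q, Q q' -> P (f q').
Proof. by move=> /subspace_continuousP cf Qq /(cf q Qq); rewrite /nbhs/=. Qed.

Lemma within_continuous_comp (T T' U : topologicalType) (Q : set T) (Q' : set T')
    (f : T -> U) (phi : T' -> T) :
  {within Q', continuous phi} -> (forall x, Q' x -> Q (phi x)) ->
  {within Q, continuous f} -> {within Q', continuous (f \o phi)}.
Proof.
move=> cphi QQ cf; apply/subspace_continuousP => x Q'x P /= Pf.
have := within_continuous_cvg cphi Q'x (within_continuous_cvg cf (QQ _ Q'x) Pf).
by apply: filterS => y h Q'y; apply: h => //; exact: QQ.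
Qed.

Section Bisection.
Context {R : realType}.

Definition rect (a1 a2 b1 b2 : R) : set (R * R) :=
  [set q | a1 <= q.1 <= a2 /\ b1 <= q.2 <= b2].

Lemma rectE (a1 a2 b1 b2 : R) : rect a1 a2 b1 b2 = `[a1, a2] `*` `[b1, b2].
Proof. by apply/seteqP; split=> q; rewrite /rect/= !in_itv. Qed.

Lemma rect_compact (a1 a2 b1 b2 : R) : compact (rect a1 a2 b1 b2).
Proof. by rewrite rectE; apply: compact_setX; exact: segment_compact. Qed.

Lemma rect_closed (a1 a2 b1 b2 : R) : closed (rect a1 a2 b1 b2).
Proof. by apply: compact_closed; [exact: norm_hausdorff|exact: rect_compact]. Qed.

(** Compactness turns the local hypothesis into a size e below which every subrectangle satisfies P;
    finitely many halvings reach that size and the two merging hypotheses climb back. Degenerate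
    rectangles are allowed, so common edges are rectangles too. *)
Lemma rect_bisection (A1 A2 B1 B2 : R) (P : R -> R -> R -> R -> Prop) :
  A1 <= A2 -> B1 <= B2 ->
  (forall a1 m a2 b1 b2, a1 <= m <= a2 -> b1 <= b2 ->
     rect a1 a2 b1 b2 `<=` rect A1 A2 B1 B2 ->
     P a1 m b1 b2 -> P m a2 b1 b2 -> P a1 a2 b1 b2) ->
  (forall a1 a2 b1 m b2, a1 <= a2 -> b1 <= m <= b2 ->
     rect a1 a2 b1 b2 `<=` rect A1 A2 B1 B2 ->
     P a1 a2 b1 m -> P a1 a2 m b2 -> P a1 a2 b1 b2) ->
  (forall q, rect A1 A2 B1 B2 q -> exists2 N, nbhs q N &
     forall a1 a2 b1 b2, rect a1 a2 b1 b2 `<=` N ->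
     rect a1 a2 b1 b2 `<=` rect A1 A2 B1 B2 -> P a1 a2 b1 b2) ->
  P A1 A2 B1 B2.
Proof.
move=> A12 B12 hx hy hloc; set Q0 := rect A1 A2 B1 B2.
pose small e (q : R * R) := forall a1 a2 b1 b2, rect a1 a2 b1 b2 q ->
  a2 - a1 <= e -> b2 - b1 <= e -> rect a1 a2 b1 b2 `<=` Q0 -> P a1 a2 b1 b2.
have : \forall e \near (0 : R)^'+, Q0 `<=` small e.
  have /compact_near_coveringP := @rect_compact A1 A2 B1 B2; apply => q Qq.
  have [N /nbhs_ballP[r /= r0 rN] PN] := hloc q Qq.
  near=> q' e => a1 a2 b1 b2 [/= /andP[h1 h2] /andP[h3 h4]] wa wb sub.
  apply: PN sub => p [/andP[p1 p2] /andP[p3 p4]]; apply: rN.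
  have er : e < r / 2 by near: e; apply: nbhs_right_lt; rewrite divr_gt0.
  have [/= d1 d2] : ball q (r / 2) q' by near: q'; apply: nbhsx_ballx; rewrite divr_gt0.
  move: d1 d2; rewrite -!ball_normE/= => /ltr_normlP[? ?] /ltr_normlP[? ?].
  rewrite /= prod_normE gt_max/=.
  by apply/andP; split; apply/ltr_normlP; split; lra.
move=> /(filterI (nbhs_right_gt 0)) /filter_ex[e [/= e0 he]].
(* One step of the induction halves both sides, so n counts the rounds needed to bring both below
   e. *)
have hn n : forall a1 a2 b1 b2, a1 <= a2 -> b1 <= b2 -> rect a1 a2 b1 b2 `<=` Q0 ->
    (a2 - a1) * 2^-1 ^+ n <= e -> (b2 - b1) * 2^-1 ^+ n <= e -> P a1 a2 b1 b2.
  elim: n => [|n IH] a1 a2 b1 b2 a12 b12 sub.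
    rewrite expr0 !mulr1 => wa wb.
    have c : rect a1 a2 b1 b2 (a1, b1) by split; rewrite /= lexx.
    exact: (he _ (sub _ c) _ _ _ _ c wa wb sub).
  rewrite exprS !mulrA => wa wb.
  pose m := (a1 + a2) / 2; pose k := (b1 + b2) / 2.
  have am : a1 <= m <= a2 by rewrite /m; apply/andP; split; lra.
  have bm : b1 <= k <= b2 by rewrite /k; apply/andP; split; lra.
  have [am1 am2] := andP am; have [bm1 bm2] := andP bm.
  have wa1 : (m - a1) * 2^-1 ^+ n <= e.
    by rewrite (_ : m - a1 = (a2 - a1) * 2^-1)// /m; field.
  have wa2 : (a2 - m) * 2^-1 ^+ n <= e.
    by rewrite (_ : a2 - m = (a2 - a1) * 2^-1)// /m; field.
  have wb1 : (k - b1) * 2^-1 ^+ n <= e.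
    by rewrite (_ : k - b1 = (b2 - b1) * 2^-1)// /k; field.
  have wb2 : (b2 - k) * 2^-1 ^+ n <= e.
    by rewrite (_ : b2 - k = (b2 - b1) * 2^-1)// /k; field.
  have subr x1 x2 z1 z2 : a1 <= x1 -> x2 <= a2 -> b1 <= z1 -> z2 <= b2 ->
      rect x1 x2 z1 z2 `<=` Q0.
    move=> ? ? ? ? q [/andP[? ?] /andP[? ?]]; apply: sub.
    by split; apply/andP; split; lra.
  by apply: (hx _ m) => //; apply: (hy _ _ _ k) => //;
    do ?[apply: subr => //]; apply: IH => //; apply: subr.
have [n1 hn1] := geometric_small (A2 - A1) e0.
have [n2 hn2] := geometric_small (B2 - B1) e0.
have le_geo (c : R) n m : 0 <= c -> c * 2^-1 ^+ n < e -> c * 2^-1 ^+ (n + m) <= e.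
  move=> c0 /ltW; apply: le_trans; rewrite ler_wpM2l// exprD ler_piMr ?exprn_ge0//.
  by rewrite exprn_ile1//; lra.
apply: (hn (n1 + n2)%N) => //; first by apply: le_geo; rewrite ?subr_ge0.
by rewrite addnC; apply: le_geo; rewrite ?subr_ge0.
Unshelve. all: by end_near. Qed.

End Bisection.

Section Lifting.
Context {R : realType} (Omega : set (R * R)) (A B : R * R -> 'M[R]_2).
Hypothesis AB : flat_sl2 Omega A B.
Local Notation par := (parallel A B).

(* [h] continues local parallel frames along [H], as in a covering space. *)
Definition lift (T : topologicalType) (Q : set T) (H : T -> R * R) (h : T -> 'M[R]_2) :=
  forall q, Q q -> exists F, (\forall p \near H q, par F p) /\
    \forall q' \near q, Q q' -> h q' = F (H q').

Lemma lift_ext (T : topologicalType) (Q : set T) H H' h h' :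
  (forall q, Q q -> H q = H' q) -> (forall q, Q q -> h q = h' q) ->
  lift Q H h -> lift Q H' h'.
Proof.
move=> HH hh lh q Qq; have [F [pF hF]] := lh q Qq; exists F.
rewrite -HH//; split=> //; apply: filterS hF => q' e Qq'.
by rewrite -HH// -hh// e.
Qed.

Lemma lift_sub (T : topologicalType) (Q Q' : set T) H h :
  Q' `<=` Q -> lift Q H h -> lift Q' H h.
Proof.
move=> QQ lh q Qq; have [F [pF hF]] := lh q (QQ _ Qq); exists F; split=> //.
by apply: filterS hF => q' e /QQ.
Qed.

Lemma lift_comp (T T' : topologicalType) (Q : set T) (Q' : set T') (phi : T' -> T) H h :
  {within Q', continuous phi} -> (forall x, Q' x -> Q (phi x)) ->
  lift Q H h -> lift Q' (H \o phi) (h \o phi).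
Proof.
move=> cphi QQ lh x Qx; have [F [pF hF]] := lh _ (QQ _ Qx); exists F; split=> //.
have := within_continuous_cvg cphi Qx hF.
by apply: filterS => y e Qy; apply: e => //; exact: QQ.
Qed.

Lemma lift_det (T : topologicalType) (Q : set T) H h q :
  lift Q H h -> Q q -> \det (h q) = 1.
Proof.
move=> lh Qq; have [F [pF hF]] := lh q Qq.
by rewrite (nbhs_singleton hF)//; have [] := nbhs_singleton pF.
Qed.

Lemma lift_mull (T : topologicalType) (Q : set T) H h (C : 'M[R]_2) : \det C = 1 ->
  lift Q H h -> lift Q H (fun q => C *m h q).
Proof.
move=> C1 lh q Qq; have [F [pF hF]] := lh q Qq; exists (fun p => C *m F p); split.
  by apply: filterS pF => p; exact: parallel_mull.
by apply: filterS hF => q' e Qq'; rewrite e.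
Qed.

Lemma lift_parallel (T : topologicalType) (Q : set T) (H : T -> R * R) F :
  (forall q, Q q -> \forall p \near H q, par F p) -> lift Q H (F \o H).
Proof. by move=> pF q Qq; exists F; split; [exact: pF|exact: nearW]. Qed.

(** Within a ball on which both are frames, [parallel_unique] applies between any two points. The
    point of agreement need not be p, as required when lifts are compared at neighbouring
    parameters. *)
Lemma near_parallel_unique F G p : Omega p ->
  (\forall q \near p, par F q) -> (\forall q \near p, par G q) ->
  \forall a \near p & b \near p, F a = G a -> F b = G b.
Proof.
case: AB => oO _ _ tr0 _ Op pF pG.
have nO : \forall q \near p, Omega q by exact: open_nbhs_nbhs.
have : \forall q \near p, Omega q /\ par F q /\ par G q.
  exact: filterI nO (filterI pF pG).
move=> /nbhs_ballP[r /= r0 hr].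
near=> a b => Fa.
apply: (@parallel_unique _ A B F G p r a b) Fa.
- by move=> q /hr[Oq _]; exact: tr0.
- by move=> q /hr[_ []].
- by move=> q /hr[_ []].
- by near: a; exact: nbhsx_ballx.
- by near: b; exact: nbhsx_ballx.
Unshelve. all: by end_near. Qed.

Lemma lift_local_unique (T : topologicalType) (Q : set T) H h1 h2 q :
  {within Q, continuous H} -> (forall q, Q q -> Omega (H q)) ->
  lift Q H h1 -> lift Q H h2 -> Q q ->
  exists2 N, nbhs q N & forall a b, N a -> N b -> Q a -> Q b ->
    h1 a = h2 a -> h1 b = h2 b.
Proof.
move=> cH HO l1 l2 Qq.
have [F1 [p1 e1]] := l1 q Qq; have [F2 [p2 e2]] := l2 q Qq.
have [[N1 N2] /= [n1 n2] FF] := near_parallel_unique (HO q Qq) p1 p2.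
have m1 := within_continuous_cvg cH Qq n1.
have m2 := within_continuous_cvg cH Qq n2.
eexists; first exact: filterI (filterI e1 e2) (filterI m1 m2).
move=> a b [[a1 a2] [a3 a4]] [[b1 b2] [b3 b4]] Qa Qb.
rewrite a1// a2// b1// b2//.
exact: (FF (H a, H b) (conj (a3 Qa) (b4 Qb))).
Qed.

(** Closedness lets a point outside one piece ignore that piece nearby. At a common point the two
    local frames agree at [H q], hence near it, and the first serves both pieces. *)
Lemma lift_glue (T : topologicalType) (Q1 Q2 : set T) H h :
  closed Q1 -> closed Q2 -> {within Q1 `|` Q2, continuous H} ->
  (forall q, (Q1 `|` Q2) q -> Omega (H q)) ->
  lift Q1 H h -> lift Q2 H h -> lift (Q1 `|` Q2) H h.
Proof.
move=> c1 c2 cH HO l1 l2 q Qq.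
have far (Q : set T) : closed Q -> ~ Q q -> \forall q' \near q, ~ Q q'.
  by move=> cQ nQ; apply: open_nbhs_nbhs; split=> //; exact: closed_openC.
have [q1|q1] := pselect (Q1 q); have [q2|q2] := pselect (Q2 q).
- have [F1 [p1 e1]] := l1 q q1; have [F2 [p2 e2]] := l2 q q2.
  exists F1; split=> //.
  have [[N1 N2] /= [n1 n2] FF] := near_parallel_unique (HO q Qq) p1 p2.
  have m2 := within_continuous_cvg cH Qq n2.
  apply: filterS (filterI (filterI e1 e2) m2) => q' [[a1 a2] a3] Qq'.
  case: (Qq') => Qi; first exact: a1.
  rewrite a2//; apply/esym/(FF (H q, H q')).
    by split; [exact: nbhs_singleton n1|exact: a3].
  by rewrite /= -(nbhs_singleton e1)// -(nbhs_singleton e2).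
- have [F1 [p1 e1]] := l1 q q1; exists F1; split=> //.
  by apply: filterS (filterI e1 (far _ c2 q2)) => q' [a1 a2] [/a1|/a2].
- have [F2 [p2 e2]] := l2 q q2; exists F2; split=> //.
  by apply: filterS (filterI e2 (far _ c1 q1)) => q' [a1 a2] [/a2|/a1].
- by case: Qq.
Qed.

Lemma lift_rect_unique (a1 a2 b1 b2 : R) H h1 h2 p q : 
  {within rect a1 a2 b1 b2, continuous H} ->
  (forall q, rect a1 a2 b1 b2 q -> Omega (H q)) ->
  lift (rect a1 a2 b1 b2) H h1 -> lift (rect a1 a2 b1 b2) H h2 ->
  rect a1 a2 b1 b2 p -> rect a1 a2 b1 b2 q -> h1 p = h2 p -> h1 q = h2 q.
Proof.
move=> cH HO l1 l2 Qp Qq.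
have a12 : a1 <= a2 by case: (Qp) => /andP[h k] _; exact: le_trans h k.
have b12 : b1 <= b2 by case: (Qp) => _ /andP[h k]; exact: le_trans h k.
(* Agreement is propagated between arbitrary points of a rectangle. After a cut it passes from one
   half to the other through an endpoint of the common edge. *)
pose P x1 x2 z1 z2 := forall p q, rect x1 x2 z1 z2 p -> rect x1 x2 z1 z2 q ->
  h1 p = h2 p -> h1 q = h2 q.
suff : P a1 a2 b1 b2 by move=> H12; exact: H12.
apply: rect_bisection a12 b12 _ _ _.
- move=> x1 m x2 z1 z2 /andP[m1 m2] z12 sub P1 P2 {}p {}q {}Qp {}Qq hp.
  have c1 : rect x1 m z1 z2 (m, z1) by split; apply/andP.
  have c2 : rect m x2 z1 z2 (m, z1) by split; apply/andP.
  have hm : h1 (m, z1) = h2 (m, z1).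
    case: Qp => /andP[p1 p2] p34.
    case/orP: (le_total p.1 m) => pm; first by apply: (P1 p) => //; split=> //; apply/andP.
    by apply: (P2 p) => //; split=> //; apply/andP.
  case: Qq => /andP[q1 q2] q34.
  case/orP: (le_total q.1 m) => pm; first by apply: P1 c1 _ hm; split=> //; apply/andP.
  by apply: P2 c2 _ hm; split=> //; apply/andP.
- move=> x1 x2 z1 m z2 x12 /andP[m1 m2] sub P1 P2 {}p {}q {}Qp {}Qq hp.
  have c1 : rect x1 x2 z1 m (x1, m) by split; apply/andP.
  have c2 : rect x1 x2 m z2 (x1, m) by split; apply/andP.
  have hm : h1 (x1, m) = h2 (x1, m).
    case: Qp => p34 /andP[p1 p2].
    case/orP: (le_total p.2 m) => pm; first by apply: (P1 p) => //; split=> //; apply/andP.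
    by apply: (P2 p) => //; split=> //; apply/andP.
  case: Qq => q34 /andP[q1 q2].
  case/orP: (le_total q.2 m) => pm; first by apply: P1 c1 _ hm; split=> //; apply/andP.
  by apply: P2 c2 _ hm; split=> //; apply/andP.
- move=> x Qx; have [N nN hN] := lift_local_unique cH HO l1 l2 Qx.
  exists N => // x1 x2 z1 z2 sN sQ u v Qu Qv.
  by apply: hN; [exact: sN|exact: sN|exact: sQ|exact: sQ].
Qed.

(* Two lifts that overlap on a rectangle are first matched there by
   a constant left factor. *)
Lemma lift_merge (Q1 Q2 : set (R * R)) (x1 x2 z1 z2 : R) H h1 h2 :
  x1 <= x2 -> z1 <= z2 -> rect x1 x2 z1 z2 = Q1 `&` Q2 ->
  closed Q1 -> closed Q2 -> {within Q1 `|` Q2, continuous H} ->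
  (forall q, (Q1 `|` Q2) q -> Omega (H q)) ->
  lift Q1 H h1 -> lift Q2 H h2 -> exists h, lift (Q1 `|` Q2) H h.
Proof.
move=> x12 z12 E c1 c2 cH HO l1 l2.
have E0 : rect x1 x2 z1 z2 (x1, z1) by split; rewrite /= lexx.
have [E1 E2] : Q1 (x1, z1) /\ Q2 (x1, z1) by move: E0; rewrite E.
pose C := h1 (x1, z1) *m mxbar (h2 (x1, z1)).
have C1 : \det C = 1.
  rewrite det_mulmx (lift_det l1 E1) mul1r.
  have := mulmx_mxbar (h2 (x1, z1)); rewrite (lift_det l2 E2) => /(congr1 determinant).
  by rewrite det_mulmx (lift_det l2 E2) mul1r det1.
have l2' := lift_mull C1 l2.
have sE : rect x1 x2 z1 z2 `<=` Q1 `|` Q2 by rewrite E => q [? _]; left.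
have s1 : rect x1 x2 z1 z2 `<=` Q1 by rewrite E => q [].
have s2 : rect x1 x2 z1 z2 `<=` Q2 by rewrite E => q [].
have e12 q : Q1 q -> Q2 q -> h1 q = C *m h2 q.
  move=> q1 q2; apply: (lift_rect_unique (continuous_subspaceW sE cH) _ (lift_sub s1 l1)
    (lift_sub s2 l2') E0).
  - by move=> ? /sE; exact: HO.
  - by rewrite E.
  - by rewrite /C -mulmxA mxbar_mulmxl (lift_det l2 E2) mulmx1.
exists (fun q => if pselect (Q1 q) then h1 q else C *m h2 q).
apply: lift_glue => //.
  by apply: lift_ext l1 => // q q1; case: pselect.
by apply: lift_ext l2' => // q q2; case: pselect => // q1; exact/esym/e12.
Qed.

(** Two halves meet in their common edge, a degenerate rectangle, and [lift_merge] matches the lifts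
    there. Locally H stays in a ball carrying a parallel frame F, and [F \o H] is a lift. *)
Lemma lift_rect_exists (a1 a2 b1 b2 : R) H : a1 <= a2 -> b1 <= b2 ->
  {within rect a1 a2 b1 b2, continuous H} ->
  (forall q, rect a1 a2 b1 b2 q -> Omega (H q)) ->
  exists h, lift (rect a1 a2 b1 b2) H h.
Proof.
move=> a12 b12 cH HO.
pose P x1 x2 z1 z2 := exists h, lift (rect x1 x2 z1 z2) H h.
suff : P a1 a2 b1 b2 by [].
apply: rect_bisection a12 b12 _ _ _.
- move=> x1 m x2 z1 z2 /andP[m1 m2] z12 sub [h1 l1] [h2 l2].
  have U : rect x1 x2 z1 z2 = rect x1 m z1 z2 `|` rect m x2 z1 z2.
    apply/seteqP; split=> q.
      move=> [/andP[q1 q2] q3]; case/orP: (le_total q.1 m) => qm; [left|right];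
        by split=> //; apply/andP.
    move=> [] [/andP[q1 q2] q3]; split=> //; apply/andP; split=> //.
      exact: le_trans m2.
    exact: le_trans q1.
  rewrite /P U; apply: (@lift_merge _ _ m m z1 z2) l1 l2 => //; rewrite -?U.
  - apply/seteqP; split=> q.
      move=> [/andP[q1 q2] q3]; split; split=> //; apply/andP; split=> //.
        exact: le_trans q1.
      exact: le_trans m2.
    by move=> [[/andP[_ q1] q3] [/andP[q2 _] _]]; split=> //; apply/andP.
  - exact: rect_closed.
  - exact: rect_closed.
  - exact: continuous_subspaceW cH.
  - by move=> q /sub; exact: HO.
- move=> x1 x2 z1 m z2 x12 /andP[m1 m2] sub [h1 l1] [h2 l2].
  have U : rect x1 x2 z1 z2 = rect x1 x2 z1 m `|` rect x1 x2 m z2.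
    apply/seteqP; split=> q.
      move=> [q3 /andP[q1 q2]]; case/orP: (le_total q.2 m) => qm; [left|right];
        by split=> //; apply/andP.
    move=> [] [q3 /andP[q1 q2]]; split=> //; apply/andP; split=> //.
      exact: le_trans m2.
    exact: le_trans q1.
  rewrite /P U; apply: (@lift_merge _ _ x1 x2 m m) l1 l2 => //; rewrite -?U.
  - apply/seteqP; split=> q.
      move=> [q3 /andP[q1 q2]]; split; split=> //; apply/andP; split=> //.
        exact: le_trans q1.
      exact: le_trans m2.
    by move=> [[q3 /andP[_ q1]] [_ /andP[q2 _]]]; split=> //; apply/andP.
  - exact: rect_closed.
  - exact: rect_closed.
  - exact: continuous_subspaceW cH.
  - by move=> q /sub; exact: HO.
- move=> q Qq; have [r r0 [_ /(_ 1%:M (det1 _ _)) [F [_ pF]]]] := local_parallel AB (HO q Qq).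
  have nF : \forall p \near H q, ball (H q) r p by exact: nbhsx_ballx.
  eexists; first exact: within_continuous_cvg cH Qq nF.
  move=> x1 x2 z1 z2 sN sQ; exists (F \o H); apply: lift_parallel => p Qp.
  have : nbhs (H p) (ball (H q) r).
    apply: open_nbhs_nbhs; split; first exact: ball_open.
    exact: sN Qp (sQ _ Qp).
  by apply: filterS => u; exact: pF.
Qed.

End Lifting.

(** * Transport along paths and its independence of the path *)

Section Transport.
Context {R : realType} (Omega : set (R * R)) (A B : R * R -> 'M[R]_2).
Hypothesis AB : flat_sl2 Omega A B.
Local Notation par := (parallel A B).
Local Notation lift := (lift A B).
Local Notation I := (`[0, 1]%classic : set R).

Lemma pair_continuous (f g : R -> R) : continuous f -> continuous g ->
  continuous (fun t => (f t, g t)).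
Proof. by move=> cf cg t; exact: cvg_pair (cf t) (cg t). Qed.

Lemma cst_pair_continuous (c : R) : continuous (fun t : R => (c, t)).
Proof. by apply: pair_continuous => t; [exact: cvg_cst|exact: cvg_id]. Qed.

Lemma pair_cst_continuous (c : R) : continuous (fun t : R => (t, c)).
Proof. by apply: pair_continuous => t; [exact: cvg_id|exact: cvg_cst]. Qed.

Lemma mem01E t : I t = (0 <= t <= 1) :> Prop.
Proof. by rewrite /= in_itv. Qed.

Lemma snd_square (q : R * R) : rect 0 1 0 1 q -> I q.2.
Proof. by rewrite mem01E => -[]. Qed.

Lemma square_snd_continuous (g : R -> R * R) : {within I, continuous g} ->
  {within rect 0 1 0 1, continuous (g \o snd)}.
Proof.
apply: within_continuous_comp; last exact: snd_square.
by apply: continuous_subspaceT => q; exact: cvg_snd.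
Qed.

Lemma rect01_pair (a b : R) : 0 <= a <= 1 -> 0 <= b <= 1 -> rect 0 1 0 1 (a, b).
Proof. by []. Qed.

Lemma zero_in01 : 0 <= (0 : R) <= 1. Proof. by rewrite lexx ler01. Qed.
Lemma one_in01 : 0 <= (1 : R) <= 1. Proof. by rewrite lexx ler01. Qed.

(** A path is read as a map of the unit square that ignores the first coordinate, so the result on
    rectangles applies. *)
Lemma lift_path_unique (g : R -> R * R) h1 h2 :
  {within I, continuous g} -> (forall t, I t -> Omega (g t)) ->
  lift I g h1 -> lift I g h2 -> h1 0 = h2 0 -> h1 1 = h2 1.
Proof.
move=> cg gO l1 l2 h0.
have cs : {within rect 0 1 0 1, continuous (snd : R * R -> R)}.
  by apply: continuous_subspaceT => q; exact: cvg_snd.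
have l1' := lift_comp cs snd_square l1.
have l2' := lift_comp cs snd_square l2.
have := lift_rect_unique AB (square_snd_continuous cg) _ l1' l2'
  (rect01_pair zero_in01 zero_in01) (rect01_pair zero_in01 one_in01).
by apply=> // q /snd_square; exact: gO.
Qed.

Lemma lift_path_exists (g : R -> R * R) :
  {within I, continuous g} -> (forall t, I t -> Omega (g t)) ->
  exists h, lift I g h.
Proof.
move=> cg gO.
have [|h lh] := lift_rect_exists AB ler01 ler01 (square_snd_continuous cg).
  by move=> q /snd_square; exact: gO.
exists (fun t => h (0, t)).
apply: (lift_comp (phi := fun t => (0, t)) _ _ lh).
  by apply: continuous_subspaceT; exact: cst_pair_continuous.
by move=> t; rewrite mem01E => t01; exact: rect01_pair zero_in01 t01.
Qed.

(** Over a constant path the constant [h 0] is itself a lift, since the frame found at time 0 serves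
    at all times; uniqueness then identifies the endpoints. *)
Lemma lift_const_path (g : R -> R * R) h p :
  {within I, continuous g} -> (forall t, I t -> Omega (g t)) ->
  lift I g h -> (forall t, I t -> g t = p) -> h 0 = h 1.
Proof.
move=> cg gO lh gp.
have I0 : I 0 by rewrite mem01E; exact: zero_in01.
suff lc : lift I g (fun=> h 0) by exact: (lift_path_unique cg gO lc lh).
move=> t It; have [F [pF hF]] := lh 0 I0.
exists F; split; first by rewrite (gp t It) -(gp 0 I0).
have h0 := nbhs_singleton hF I0.
by apply: filterE => s Is; rewrite h0 (gp 0 I0) (gp s Is).
Qed.

(** A relation, since different paths may a priori carry C to different values; [transport_loop]
    removes the ambiguity. *)
Definition transport p C q D := exists g h,
  [/\ {within I, continuous g}, forall t, I t -> Omega (g t), lift I g h,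
      g 0 = p /\ g 1 = q & h 0 = C /\ h 1 = D].

Lemma transport_det p C q D : transport p C q D ->
  [/\ Omega p, Omega q, \det C = 1 & \det D = 1].
Proof.
move=> [g [h [_ gO lh [<- <-] [<- <-]]]].
have I0 : I 0 by rewrite mem01E; exact: zero_in01.
have I1 : I 1 by rewrite mem01E; exact: one_in01.
by split; [exact: gO|exact: gO|exact: lift_det lh _|exact: lift_det lh _].
Qed.

Lemma transport_sym p C q D : transport p C q D -> transport q D p C.
Proof.
move=> [g [h [cg gO lh [g0 g1] [h0 h1]]]].
pose phi (t : R) := 1 - t.
have cphi : {within I, continuous phi}.
  by apply: continuous_subspaceT => t; apply: cvgB; [exact: cvg_cst|exact: cvg_id].
have pI t : I t -> I (phi t).
  by rewrite !mem01E /phi => /andP[? ?]; apply/andP; split; lra.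
exists (g \o phi), (h \o phi); split.
- exact: within_continuous_comp cphi pI cg.
- by move=> t /pI; exact: gO.
- exact: lift_comp cphi pI lh.
- by rewrite /phi/= subrr subr0.
- by rewrite /phi/= subrr subr0.
Qed.

Lemma two_sub_one : 2 * 1 - 1 = 1 :> R. Proof. by ring. Qed.

Lemma transport_trans p C q D u X :
  transport p C q D -> transport q D u X -> transport p C u X.
Proof.
move=> [g [h [cg gO lh [g0 g1] [h0 h1]]]] [g' [h' [cg' gO' lh' [g0' g1'] [h0' h1']]]].
pose phi (t : R) := 2 * t; pose psi (t : R) := 2 * t - 1.
pose I1 : set R := `[0, 2^-1]%classic; pose I2 : set R := `[2^-1, 1]%classic.
have IE : I = I1 `|` I2.
  apply/seteqP; split=> t; rewrite mem01E.
    move=> /andP[t0 t1]; have [t2|/ltW t2] := leP t 2^-1; [left|right];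
      by rewrite /I1 /I2 /= in_itv/= ?t0 ?t1 ?t2.
  by rewrite /I1 /I2 => -[]; rewrite /= in_itv/= => /andP[? ?]; apply/andP; split; lra.
have cphi : {within I1, continuous phi}.
  by apply: continuous_subspaceT => t; apply: cvgMr; exact: cvg_id.
have cpsi : {within I2, continuous psi}.
  by apply: continuous_subspaceT => t; apply: cvgB; [apply: cvgMr; exact: cvg_id|exact: cvg_cst].
have pI t : I1 t -> I (phi t).
  by rewrite mem01E /I1/= in_itv/= /phi => /andP[? ?]; apply/andP; split; lra.
have sI t : I2 t -> I (psi t).
  by rewrite mem01E /I2/= in_itv/= /psi => /andP[? ?]; apply/andP; split; lra.
pose join (W : Type) (x y : R -> W) t := if t <= 2^-1 then x (phi t) else y (psi t).
have j1 W (x y : R -> W) t : I1 t -> (x \o phi) t = join _ x y t.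
  by rewrite /I1/= in_itv/= /join => /andP[_ ->].
(* The midpoint belongs to both halves, and there the two formulas agree only through
   [x 1 = y 0]. *)
have j2 W (x y : R -> W) t : x 1 = y 0 -> I2 t -> (y \o psi) t = join _ x y t.
  rewrite /I2/= in_itv/= /join /= => xy /andP[t2 _]; case: ifP => // t1.
  have -> : t = 2^-1 by apply/eqP; rewrite eq_le t1.
  by rewrite /phi /psi divff ?subrr// pnatr_eq0.
have join0 W (x y : R -> W) : join _ x y 0 = x 0.
  by rewrite /join invr_ge0 ler0n /phi mulr0.
have join1 W (x y : R -> W) : join _ x y 1 = y 1.
  by rewrite /join /psi leNgt invf_lt1 ?ltr0n// ltr1n/= two_sub_one.
have gg : g 1 = g' 0 by rewrite g1 g0'.
have hh : h 1 = h' 0 by rewrite h1 h0'.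
have c1 : closed I1 by exact: itv_closed.
have c2 : closed I2 by exact: itv_closed.
have cj : {within I1 `|` I2, continuous (join _ g g')}.
  apply: withinU_continuous => //.
    apply: (subspace_eq_continuous (f := g \o phi)).
      by move=> t /set_mem It; exact: j1.
    exact: within_continuous_comp cphi pI cg.
  apply: (subspace_eq_continuous (f := g' \o psi)).
    by move=> t /set_mem It; exact: j2.
  exact: within_continuous_comp cpsi sI cg'.
have jO t : (I1 `|` I2) t -> Omega (join _ g g' t).
  by move=> [It|It]; [rewrite -j1//; exact/gO/pI|rewrite -j2//; exact/gO'/sI].
exists (join _ g g'), (join _ h h'); split.
- by rewrite IE.
- by rewrite IE.
- rewrite IE; apply: (lift_glue AB) => //.
    apply: lift_ext (lift_comp cphi pI lh); exact: j1.
  by apply: lift_ext (lift_comp cpsi sI lh') => t It; exact: j2.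
- by rewrite !join0 !join1.
- by rewrite !join0 !join1.
Qed.

Lemma transport_exists p C q : path_connected R Omega -> Omega p -> Omega q ->
  \det C = 1 -> exists D, transport p C q D.
Proof.
move=> pc Op Oq C1; have [g [cg gO g0 g1]] := pc p q Op Oq.
have {}gO t : I t -> Omega (g t) by rewrite mem01E; exact: gO.
have [h lh] := lift_path_exists cg gO.
have I0 : I 0 by rewrite mem01E; exact: zero_in01.
have h01 := lift_det lh I0.
(* The constant left factor that moves the initial value [h 0] to C. *)
pose E := C *m mxbar (h 0).
have E1 : \det E = 1.
  rewrite det_mulmx C1 mul1r; have := mulmx_mxbar (h 0).
  by rewrite h01 => /(congr1 determinant); rewrite det_mulmx h01 mul1r det1.
exists (E *m h 1), g, (fun t => E *m h t); split=> //.
  exact: lift_mull.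
by rewrite /E -!mulmxA mxbar_mulmxl h01 mulmx1.
Qed.

Lemma transport_ball p r q F : 0 < r -> ball p r `<=` Omega ->
  (forall q, ball p r q -> par F q) -> ball p r q -> transport p (F p) q (F q).
Proof.
move=> r0 bO pF bq; pose g (t : R) := t *: (q - p) + p.
have gb t : I t -> ball p r (g t).
  by rewrite mem01E; apply: ball_line => //; exact: ballxx.
have g0 : g 0 = p by rewrite /g scale0r add0r.
have g1 : g 1 = q by rewrite /g scale1r subrK.
exists g, (F \o g); split=> //.
- apply: continuous_subspaceT => t; apply: cvgD; last exact: cvg_cst.
  by apply: cvgZl; exact: cvg_id.
- by move=> t /gb; exact: bO.
- apply: lift_parallel => t /gb bt.
  have : nbhs (g t) (ball p r).
    by apply: open_nbhs_nbhs; split; [exact: ball_open|].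
  by apply: filterS => u; exact: pF.
- by rewrite /= g0 g1.
Qed.

(** Lift the contraction H to k on the square. On three edges H is constant, hence so is the lift
    between their ends, and k agrees at the two ends of the remaining edge. That edge carries g, so
    by uniqueness h is k there up to a constant left factor. *)
Lemma transport_loop p C D : loops_contractible R Omega -> transport p C p D -> C = D.
Proof.
move=> lc [g [h [cg gO lh [g0 g1] [h0 h1]]]].
have gO' t : 0 <= t <= 1 -> Omega (g t) by rewrite -mem01E; exact: gO.
have [H [cH HO Hg Hb]] := lc g cg gO' (etrans g0 (esym g1)).
rewrite -rectE in cH.
have HO' q : rect 0 1 0 1 q -> Omega (H q) by case: q => s t [/= hs ht]; exact: HO.
have [k lk] := lift_rect_exists AB ler01 ler01 cH HO'.
pose edge (phi : R -> R * R) := continuous phi /\ forall t, I t -> rect 0 1 0 1 (phi t).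
have edge_path phi : edge phi -> [/\ {within I, continuous (H \o phi)},
    forall t, I t -> Omega ((H \o phi) t) & lift I (H \o phi) (k \o phi)].
  move=> [cphi pI]; have cphi' : {within I, continuous phi} by exact: continuous_subspaceT.
  split; first exact: within_continuous_comp cphi' pI cH.
    by move=> t /pI; exact: HO'.
  exact: lift_comp cphi' pI lk.
have const phi : edge phi -> (forall t, 0 <= t <= 1 -> H (phi t) = g 0) ->
    k (phi 0) = k (phi 1).
  move=> /edge_path[cp pO lp] Hp.
  by apply: (lift_const_path cp pO lp) => t; rewrite mem01E; exact: Hp.
have e_left : edge (fun t => (0, t)).
  split=> [|t]; first exact: cst_pair_continuous.
  by rewrite mem01E => t01; exact: rect01_pair zero_in01 t01.
have e_right : edge (fun t => (1, t)).
  split=> [|t]; first exact: cst_pair_continuous.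
  by rewrite mem01E => t01; exact: rect01_pair one_in01 t01.
have e_bot : edge (fun t => (t, 0)).
  split=> [|t]; first exact: pair_cst_continuous.
  by rewrite mem01E => t01; exact: rect01_pair t01 zero_in01.
have e_top : edge (fun t => (t, 1)).
  split=> [|t]; first exact: pair_cst_continuous.
  by rewrite mem01E => t01; exact: rect01_pair t01 one_in01.
have k1 := const _ e_bot (fun t t01 => (Hb t t01).1).
have k2 := const _ e_right (fun t t01 => (Hg t t01).2).
have k3 := const _ e_top (fun t t01 => (Hb t t01).2).
have k01 : k (0, 0) = k (0, 1) by rewrite /= k1 k2 -k3.
have [cl Ol ll] := edge_path _ e_left.
have lh' : lift I (H \o (fun t => (0, t))) h.
  by apply: lift_ext lh => // t; rewrite mem01E => /Hg[].
have I0 : I 0 by rewrite mem01E; exact: zero_in01.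
have k0 : \det (k (0, 0)) = 1 by exact: lift_det lk (rect01_pair zero_in01 zero_in01).
pose E := C *m mxbar (k (0, 0)).
have C1 : \det C = 1 by rewrite -h0; exact: lift_det lh I0.
have E1 : \det E = 1.
  rewrite det_mulmx C1 mul1r; have := mulmx_mxbar (k (0, 0)).
  by rewrite k0 => /(congr1 determinant); rewrite det_mulmx k0 mul1r det1.
have E0 : E *m k (0, 0) = C by rewrite /E -mulmxA mxbar_mulmxl k0 mulmx1.
have := lift_path_unique cl Ol lh' (lift_mull E1 ll).
by rewrite /= E0 h0 h1 => /(_ erefl) ->; rewrite -k01 E0.
Qed.

Theorem flat_integrable : simply_connected R Omega ->
  exists f, forall p, Omega p -> par f p.
Proof.
move=> [pc lc]; have [[p0 Op0]|nO] := pselect (exists p, Omega p); last first.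
  by exists (fun=> 0) => p Op; case: nO; exists p.
have exf q : exists D, Omega q -> transport p0 1%:M q D.
  have [Oq|nOq] := pselect (Omega q); last by exists 0.
  by have [D hD] := transport_exists pc Op0 Oq (det1 _ _); exists D.
have [f hf] := choice exf; exists f => p Op.
have [_ _ _ fp1] := transport_det (hf p Op).
have [r r0 [bO /(_ _ fp1) [F [Fp pF]]]] := local_parallel AB Op.
apply: (near_eq_parallel (F := F)); last by apply: pF; exact: ballxx.
(* Near p, f is the local frame F with F p = f p: going back from (q, F q) through p to the base
   point and out again to (q, f q) is a loop at q. *)
near=> q.
have bq : ball p r q by near: q; exact: nbhsx_ballx.
have := transport_ball r0 bO pF bq; rewrite Fp => t1.
have t2 := transport_trans (hf p Op) t1.
apply: (transport_loop lc).
exact: transport_trans (transport_sym t2) (hf q (bO _ bq)).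
Unshelve. all: by end_near. Qed.

End Transport.

(** * Geometry of the Gauss map *)

Section Sl2.
Context {R : realType}.
Implicit Types (C M N X Y : 'M[R]_2).

Lemma sl2_mxbar X : sl2 X -> mxbar X = - X.
Proof. by rewrite /sl2/= /mxbar => ->; rewrite raddf0 sub0r. Qed.

Lemma mxbar_sl2 X : mxbar X = - X -> sl2 X.
Proof.
have := addmx_mxbar X => + XN; rewrite XN subrr /sl2/= => /matrixP/(_ 0 0).
by rewrite !mxE/= mulr1n.
Qed.

(** Cayley-Hamilton for a traceless matrix of determinant -1. *)
Lemma S21_sqr N : S21 N -> N *m N = 1%:M.
Proof.
move=> [N0]; rewrite ip_det => N1; have := mulmx_mxbar N.
rewrite (sl2_mxbar N0) mulmxN => /eqP; rewrite eqr_oppLR => /eqP ->.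
by rewrite -raddfN N1.
Qed.

(** Left translation by SL(2) is an isometry. Translation by f nu, of determinant -1, reverses the
    form; this is the sign in the first fundamental form of f. *)
Lemma ip_mulmxl C X Y : ip (C *m X) (C *m Y) = \det C * ip X Y.
Proof.
rewrite /ip mxbar_mulmx -mulmxA mxtrace_mulC -!mulmxA mxbar_mulmxl.
by rewrite mul_mx_scalar -scalemxAr mxtraceZ; ring.
Qed.

Lemma ip_scalell c X Y : ip (c *: X) Y = c * ip X Y.
Proof. by rewrite /ip -scalemxAl mxtraceZ; ring. Qed.

Lemma ip_addl X Y M : ip (X + Y) M = ip X M + ip Y M.
Proof. by rewrite /ip mulmxDl mxtraceD; ring. Qed.

Lemma ipC X Y : ip X Y = ip Y X.
Proof.
by rewrite /ip /mxbar !tr2 !mulmx2E !mxE/= !mulr1n !mulr0n; ring.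
Qed.

Lemma ip_scalar c X : sl2 X -> ip c%:M X = 0.
Proof.
move=> X0; rewrite ip_sl2// mul_scalar_mx mxtraceZ; move: X0; rewrite /sl2/= => ->.
by rewrite !mulr0.
Qed.

(** The Clifford relation of the form, polarised from X^2 = <X, X> on sl(2). *)
Lemma sl2_anticomm X Y : sl2 X -> sl2 Y -> X *m Y + Y *m X = (2 * ip X Y)%:M.
Proof.
move=> X0 Y0; rewrite ip_sl2//; move: X0 Y0; rewrite /sl2/= !tr2.
move=> /eqP; rewrite addr_eq0 => /eqP X0 /eqP; rewrite addr_eq0 => /eqP Y0.
by apply/mx2P; rewrite !addmx2E !mulmx2E !mxE/= !mulr1n !mulr0n X0 Y0; split; field.
Qed.

Lemma lie_anticomm N X : N *m X + X *m N = 0 -> lie N X = 2 *: (N *m X).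
Proof.
move=> /eqP; rewrite addrC addr_eq0 => /eqP XN.
by rewrite /lie XN opprK -mulr2n scaler_nat.
Qed.

Variables N X Y : 'M[R]_2.
Hypotheses (N1 : S21 N) (X0 : sl2 X) (Y0 : sl2 Y).
Hypotheses (NX : N *m X + X *m N = 0) (NY : N *m Y + Y *m N = 0).

Lemma anticommX : X *m N = - (N *m X).
Proof. by apply/eqP; rewrite -addr_eq0 addrC NX. Qed.

Lemma anticommY : Y *m N = - (N *m Y).
Proof. by apply/eqP; rewrite -addr_eq0 addrC NY. Qed.

(** Moving the second N past Z costs a sign and produces N^2 = 1. *)
Lemma normal_cancel (a b : R) (Z W : 'M[R]_2) : Z *m N = - (N *m Z) ->
  (a *: (N *m Z)) *m (b *: (N *m W)) = - (a * b) *: (Z *m W).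
Proof.
move=> ZN; rewrite -scalemxAl -scalemxAr scalerA -!mulmxA (mulmxA Z) ZN.
by rewrite !mulNmx mulmxN !mulmxA (S21_sqr N1) mul1mx scalerN scaleNr.
Qed.

Definition triple := ip (X *m Y) N.

(** X Y + Y X is a scalar matrix, hence orthogonal to the traceless N. *)
Lemma triple_swap : ip (Y *m X) N = - triple.
Proof.
apply/eqP; rewrite -addr_eq0 /triple -ip_addl addrC sl2_anticomm//.
by rewrite ip_scalar//; case: N1.
Qed.

(** N anticommutes with X and Y, so it commutes with X Y and Y X; by [lie_S21_eq0] a traceless
    matrix commuting with N is a multiple of N. *)
Lemma lie_tangent : lie X Y = (2 * triple) *: N.
Proof.
have W0 : sl2 (lie X Y) by rewrite /sl2/= /lie linearB/= mxtrace_mulC subrr.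
have := (lie_S21_eq0 N1 W0).1 _ => /(_ _)/subr0_eq ->.
  by rewrite /lie ip_addl -scaleN1r ip_scalell triple_swap; congr (_ *: _); rewrite /triple; ring.
have c (Z W : 'M[R]_2) : Z *m N = - (N *m Z) -> W *m N = - (N *m W) ->
    N *m (Z *m W) = Z *m W *m N.
  by move=> ZN WN; rewrite -mulmxA WN mulmxN !mulmxA ZN mulNmx opprK.
rewrite {1}/lie /lie mulmxBr mulmxBl !c ?subrr//.
all: by [exact: anticommX|exact: anticommY].
Qed.

Lemma gram_triple : ip X X * ip Y Y - ip X Y ^+ 2 = - triple ^+ 2.
Proof.
have [N0 N11] := N1.
have NX0 : ip N X = 0.
  have := sl2_anticomm N0 X0; rewrite NX => /matrixP/(_ 0 0).
  by rewrite !mxE/= mulr1n => /eqP; rewrite eq_sym mulf_eq0 pnatr_eq0/= => /eqP.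
have NY0 : ip N Y = 0.
  have := sl2_anticomm N0 Y0; rewrite NY => /matrixP/(_ 0 0).
  by rewrite !mxE/= mulr1n => /eqP; rewrite eq_sym mulf_eq0 pnatr_eq0/= => /eqP.
(* The left side is the Gram determinant of the traceless N, X, Y, expanded along N. Only its first
   term survives, as N is a unit vector orthogonal to X and Y. *)
have gram : ip N N * (ip X X * ip Y Y - ip X Y ^+ 2)
   - ip N X * (ip N X * ip Y Y - ip N Y * ip X Y)
   + ip N Y * (ip N X * ip X Y - ip N Y * ip X X) = - triple ^+ 2.
  move: N0 X0 Y0; rewrite /triple /sl2/= !tr2.
  move=> /eqP; rewrite addr_eq0 => /eqP N0; move=> /eqP; rewrite addr_eq0 => /eqP X0'.
  move=> /eqP; rewrite addr_eq0 => /eqP Y0'.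
  rewrite /ip /mxbar !tr2 !mulmx2E !(addmx2E, oppmx2E, mulmx2E) !mxE/= !mulr1n !mulr0n.
  by rewrite N0 X0' Y0'; field.
by move: gram; rewrite NX0 NY0 N11; lra.
Qed.

Hypothesis free : forall u v : R, u *: X + v *: Y = 0 -> u = 0 /\ v = 0.

(** If the triple product vanishes, X and Y commute by [lie_tangent]. For traceless 2 by 2 matrices
    this makes all the products in [kill] symmetric, so X and Y are proportional, against their
    independence. *)
Lemma triple_neq0 : triple != 0.
Proof.
apply/eqP => T0; have := lie_tangent; rewrite T0 mulr0 scale0r => XY.
have kill i j k l : X i j * Y k l = X k l * Y i j.
  have e00 : X 0 0 = - X 1 1 by move: X0; rewrite /sl2/= tr2 => /eqP; rewrite addr_eq0 => /eqP.
  have f00 : Y 0 0 = - Y 1 1 by move: Y0; rewrite /sl2/= tr2 => /eqP; rewrite addr_eq0 => /eqP.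
  have E m n : (X *m Y) m n = (Y *m X) m n.
    by move/matrixP/(_ m n): XY; rewrite addmx2E oppmx2E [RHS]mxE => /subr0_eq.
  have := (E 0 0, E 0 1, E 1 0); rewrite !mulmx2E e00 f00 => -[[h1 h2] h3].
  move: i j k l; apply: ord2P; apply: ord2P; apply: ord2P; apply: ord2P;
    rewrite ?e00 ?f00; lra.
have Z i j : X i j = 0 /\ Y i j = 0.
  have [] := @free (Y i j) (- X i j); last by move=> -> /eqP; rewrite oppr_eq0 => /eqP.
  by apply/matrixP => k l; rewrite addmx2E !scalemx2E mxE mulNr mulrC kill; ring.
have [] := @free 1 0; last by move/eqP; rewrite oner_eq0.
by apply/matrixP => k l; rewrite addmx2E !scalemx2E mxE (Z k l).1 (Z k l).2; ring.
Qed.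

End Sl2.

Lemma lorentzian_det (R : realType) (B : R * R -> R * R -> R) (e f g : R) :
  (forall v w, B v w = e * (v.1 * w.1) + f * (v.1 * w.2 + v.2 * w.1) + g * (v.2 * w.2)) ->
  e * g - f ^+ 2 < 0 -> lorentzian B.
Proof.
move=> BE D0.
have [e0|e0] := eqVneq e 0.
  have f0 : f != 0.
    by apply: contraTneq D0 => ->; rewrite e0 mul0r expr0n subrr ltxx.
  (* With e = 0 a vector (x, 1) has square 2 f x + g; the two values of x make it -1 and 1, and the
     vectors turn out orthogonal. *)
  exists ((-1 - g) / (2 * f), 1), ((1 - g) / (2 * f), 1).
  by split; rewrite BE/= e0; field.
pose d := f ^+ 2 - e * g.
have d0 : 0 < d by rewrite /d; lra.
have inv_sqrt (x : R) : 0 < x -> (Num.sqrt x)^-1 ^+ 2 * x = 1.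
  move=> x0; rewrite exprVn sqr_sqrtr ?ltW// mulVf// gt_eqF//.
(* The vector (-f, e) is orthogonal to (1, 0) and has square -e d. Its sign is opposite to that of
   e, so normalising the two gives the basis. *)
case: (ltgtP e 0) e0 => // es _.
  have e1 : 0 < - e by lra.
  have ed : 0 < - e * d by rewrite mulr_gt0.
  exists ((Num.sqrt (- e))^-1, 0), (- f / Num.sqrt (- e * d), e / Num.sqrt (- e * d)).
  have := inv_sqrt _ e1; have := inv_sqrt _ ed.
  move: (_ ^-1) (_ ^-1) => y x hy hx; split; rewrite BE/=; last by ring.
    by rewrite -[in RHS]hx; ring.
  by rewrite -[in RHS]hy /d; ring.
have ed : 0 < e * d by rewrite mulr_gt0.
exists (- f / Num.sqrt (e * d), e / Num.sqrt (e * d)), ((Num.sqrt e)^-1, 0).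
have := inv_sqrt _ es; have := inv_sqrt _ ed.
move: (_ ^-1) (_ ^-1) => y x hy hx; split; rewrite BE/=; last by ring.
  by rewrite -[in RHS]hy /d; ring.
by rewrite -[in RHS]hx; ring.
Qed.

Section Differential2.
Context {R : realType}.
Implicit Types F G : R * R -> 'M[R]_2.

Lemma diff_pd F p (w : R * R) : differentiable F p ->
  'd F p w = w.1 *: dx F p + w.2 *: dy F p.
Proof.
move=> dF.
have ex : dx F p = 'd F p ((1, 0) : R * R) by exact: deriveE.
have ey : dy F p = 'd F p ((0, 1) : R * R) by exact: deriveE.
rewrite ex ey.
have {1}-> : w = w.1 *: ((1, 0) : R * R) + w.2 *: ((0, 1) : R * R).
  by case: w => a b; congr (_, _); rewrite /= /GRing.scale/= ?mulr1 ?mulr0 ?addr0 ?add0r.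
by rewrite linearD !linearZ.
Qed.

Lemma pd_near F G i p (dF dG : 'M[R]_2) : (\forall q \near p, F q = G q) ->
  is_derive p (dir R i) F dF -> is_derive p (dir R i) G dG -> dF = dG.
Proof.
move=> FG [_ EF] [_ EG]; rewrite -EF -EG.
exact: near_eq_derive.
Qed.

Lemma pd_is_derive F i p : differentiable F p -> is_derive p (dir R i) F (pd i F p).
Proof. by move=> dF; split=> //; exact: diff_derivable. Qed.

Lemma is_derive_lie F G p v (dF dG : 'M[R]_2) :
  is_derive p v F dF -> is_derive p v G dG ->
  is_derive p v (fun q => lie (F q) (G q)) (lie dF (G p) + lie (F p) dG).
Proof.
move=> DF DG.
have D := is_deriveB (is_derive_mulmx DF DG) (is_derive_mulmx DG DF).
apply: is_derive_eq D _; rewrite /lie.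
by apply/matrixP => k l; rewrite !(addmx2E, oppmx2E); ring.
Qed.

End Differential2.

Lemma flat_algebra (R : realType) (N X Y : 'M[R]_2) (a b : R) : S21 N ->
  X *m N = - (N *m X) -> Y *m N = - (N *m Y) -> a + b = 4 * a * b ->
  a *: lie Y X - b *: lie X Y =
  (2 * a) *: (N *m X) *m ((2 * b) *: (N *m Y))
  - (2 * b) *: (N *m Y) *m ((2 * a) *: (N *m X)).
Proof.
move=> N1 XN YN ab; rewrite !(normal_cancel N1)//.
have e : 2 * a * (2 * b) = a + b by rewrite ab; ring.
rewrite (mulrC (2 * b)) e /lie; move: (X *m Y) (Y *m X) => P Q.
by apply/matrixP => k l; rewrite !(addmx2E, oppmx2E, scalemx2E); ring.
Qed.

Section GaussMap.
Context {R : realType} (Omega : set (R * R)) (nu : R * R -> 'M[R]_2).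
Hypotheses (oO : open Omega) (nuS : maps_into Omega nu (@S21 R)).
Hypothesis nui : immersion_on Omega nu.

Lemma nu_smooth : smooth_on Omega nu. Proof. by case: nui. Qed.

Lemma nu_diff p : Omega p -> differentiable nu p.
Proof. exact: smooth_on_diff nu_smooth. Qed.

Lemma nu_pd_smooth i : smooth_on Omega (pd i nu).
Proof. exact: smooth_on_pd nu_smooth. Qed.

(** Differentiate [mxbar nu = - nu], which expresses tracelessness. *)
Lemma nu_pd_sl2 i p : Omega p -> sl2 (pd i nu p).
Proof.
move=> Op; apply: mxbar_sl2.
have D := pd_is_derive i (nu_diff Op).
apply: (pd_near (F := fun q => mxbar (nu q)) _ (is_derive_mxbar D) (is_deriveN D)).
by apply: (near_open oO Op) => q /nuS[q0 _]; exact: sl2_mxbar.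
Qed.

(** The derivative of nu^2 = 1. *)
Lemma nu_anticomm i p : Omega p -> nu p *m pd i nu p + pd i nu p *m nu p = 0.
Proof.
move=> Op; have D := pd_is_derive i (nu_diff Op); rewrite addrC.
apply: (pd_near (F := fun q => nu q *m nu q) _ (is_derive_mulmx D D)
  (is_derive_cst (1%:M : 'M[R]_2) p (dir R i))).
by apply: (near_open oO Op) => q /nuS; exact: S21_sqr.
Qed.

Lemma nu_free p : Omega p ->
  forall u v : R, u *: dx nu p + v *: dy nu p = 0 -> u = 0 /\ v = 0.
Proof.
move=> Op u v uv; case: nui => _ /(_ p Op (u, v) 0) inj.
suff [-> ->] : (u, v) = 0 by [].
by apply: inj; rewrite linear0 diff_pd//; exact: nu_diff.
Qed.

Definition conn (c : R) i (q : R * R) : 'M[R]_2 := c *: lie (nu q) (pd i nu q).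

Lemma connE c i p : Omega p -> conn c i p = (2 * c) *: (nu p *m pd i nu p).
Proof.
by move=> Op; rewrite /conn lie_anticomm ?scalerA 1?mulrC//; exact: nu_anticomm.
Qed.

Lemma conn_smooth c i : smooth_on Omega (conn c i).
Proof.
apply: smooth_onZ => //.
apply: (smooth_on_ext oO (F := fun q => nu q *m pd i nu q + -1 *: (pd i nu q *m nu q))).
  by move=> q _; rewrite scaleN1r.
apply: smooth_onD => //; last apply: smooth_onZ => //.
  by apply: smooth_on_mulmx => //; [exact: nu_smooth|exact: nu_pd_smooth].
by apply: smooth_on_mulmx => //; [exact: nu_pd_smooth|exact: nu_smooth].
Qed.

Lemma pd_conn c i j p : Omega p -> pd j (conn c i) p =
  c *: (lie (pd j nu p) (pd i nu p) + lie (nu p) (pd j (pd i nu) p)).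
Proof.
move=> Op; have D := pd_is_derive j (nu_diff Op).
have D2 := pd_is_derive j (smooth_on_diff (@nu_pd_smooth i) Op).
by have [_ E] := is_deriveZ c (is_derive_lie D D2).
Qed.

Lemma pd_conn_lie0 c i j p : Omega p -> lie (nu p) (pd j (pd i nu) p) = 0 ->
  pd j (conn c i) p = c *: lie (pd j nu p) (pd i nu p).
Proof.
move=> Op h; apply: etrans (pd_conn c i j Op) _.
apply: etrans (congr1 (fun Z => c *: (lie (pd j nu p) (pd i nu p) + Z)) h) _.
by rewrite addr0.
Qed.

Lemma lie_trace (X Y : 'M[R]_2) : \tr (lie X Y) = 0.
Proof. by rewrite /lie linearB/= mxtrace_mulC subrr. Qed.

Hypothesis nuh : harmonic Omega nu.

Lemma conn_flat (a b : R) : a + b = 4 * a * b ->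
  flat_sl2 Omega (conn a ord0) (conn b ord_max).
Proof.
move=> ab; split=> //; try exact: conn_smooth.
  by move=> q _; split; rewrite /conn mxtraceZ lie_trace mulr0.
move=> q Oq.
have h1 : lie (nu q) (pd ord_max (pd ord0 nu) q) = 0 by exact: nuh.
have h2 : lie (nu q) (pd ord0 (pd ord_max nu) q) = 0.
  apply: etrans h1; apply: (congr1 (lie (nu q))).
  exact: (smooth_on_pdC oO ord_max ord0 nu_smooth Oq).
have dA : dy (conn a ord0) q = _ := pd_conn_lie0 a Oq h1.
have dB : dx (conn b ord_max) q = _ := pd_conn_lie0 b Oq h2.
rewrite dA dB (connE a ord0 Oq) (connE b ord_max Oq) {dA dB h1 h2}.
have c i := anticommX (nu_anticomm i Oq).
exact: flat_algebra (nuS Oq) (c ord0) (c ord_max) ab.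
Qed.

End GaussMap.

(** * Derivatives and smoothness of a parallel frame *)

Section Frame.
Context {R : realType} (Omega : set (R * R)) (A B f : R * R -> 'M[R]_2).
Hypotheses (AB : flat_sl2 Omega A B) (pf : forall p, Omega p -> parallel A B f p).

Definition coef (i : 'I_2) := if i == ord0 then A else B.

Lemma coef_smooth i : smooth_on Omega (coef i).
Proof. by case: AB => _ sA sB _ _; rewrite /coef; case: ifP. Qed.

Lemma frame_diff p : Omega p -> differentiable f p.
Proof. by case/pf. Qed.

Lemma frame_pd i p : Omega p -> pd i f p = f p *m coef i p.
Proof.
move=> Op; have [df E _] := pf Op.
apply: etrans (deriveE (dir R i) df) _; apply: etrans (E _) _; congr (_ *m _).
rewrite /dir /coef; case: ifP => _ /=.
  by rewrite scale1r scale0r addr0.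
by rewrite scale1r scale0r add0r.
Qed.

Lemma frame_pd_mul i (S : R * R -> 'M[R]_2) p : smooth_on Omega S -> Omega p ->
  pd i (fun q => f q *m S q) p = f p *m (coef i p *m S p + pd i S p).
Proof.
move=> sS Op; rewrite pd_mulmx; [|exact: frame_diff|exact: smooth_on_diff sS Op].
by rewrite frame_pd// mulmxDr mulmxA.
Qed.

(** Bootstrap from the first-order equation: the maps f S with S smooth form a class closed under
    partial derivatives, since the new factor is [coef i *m S + pd i S]. *)
Lemma frame_smooth : smooth_on Omega f.
Proof.
have oO : open Omega by case: AB.
apply: (@smooth_on_ext _ _ oO _ (fun q => f q *m 1%:M)).
  by move=> p _; rewrite mulmx1.
apply: (@smooth_on_closed _ _ oO _ (fun X => exists2 S : R * R -> 'M[R]_2,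
  smooth_on Omega S & X = fun q => f q *m S q)).
- move=> _ p [S sS ->] Op; apply: differentiable_mulmx; first exact: frame_diff.
  exact: smooth_on_diff sS Op.
- move=> _ i [S sS ->]; exists (fun p => f p *m (coef i p *m S p + pd i S p)).
    exists (fun p => coef i p *m S p + pd i S p) => //.
    apply: smooth_onD => //; last exact: smooth_on_pd.
    by apply: smooth_on_mulmx => //; exact: coef_smooth.
  by move=> p Op; rewrite frame_pd_mul.
- by exists (cst 1%:M) => //; exact: smooth_on_cst.
Qed.

Lemma frame_pd_pd i j p : Omega p ->
  pd j (pd i f) p = f p *m (coef j p *m coef i p + pd j (coef i) p).
Proof.
move=> Op; rewrite -frame_pd_mul//; last exact: coef_smooth.
apply: near_eq_derive; have oO : open Omega by case: AB.
by apply: (near_open oO Op) => q Oq; exact: frame_pd.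
Qed.

End Frame.

Section PointwiseGeometry.
Context {R : realType}.
Implicit Types (C N X Y Z : 'M[R]_2) (a b r s : R) (v w : R * R).

Lemma mulmx_combination C N X Y (x y r s : R) :
  C *m (x *: (r *: (N *m X)) + y *: (s *: (N *m Y))) =
  C *m N *m (x *: (r *: X) + y *: (s *: Y)).
Proof. by rewrite !mulmxDr -!scalemxAr !mulmxA. Qed.

Lemma ip_frame C X Y r s v w : \det C = -1 ->
  ip (C *m (v.1 *: (r *: X) + v.2 *: (s *: Y)))
     (C *m (w.1 *: (r *: X) + w.2 *: (s *: Y))) =
  (- (r ^+ 2 * ip X X)) * (v.1 * w.1) + (- (r * s * ip X Y)) * (v.1 * w.2 + v.2 * w.1)
  + (- (s ^+ 2 * ip Y Y)) * (v.2 * w.2).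
Proof.
move=> C1; rewrite ip_mulmxl C1 !ip_addl !ip_scalell.
rewrite ![ip _ (_ + _)]ipC !ip_addl !ip_scalell (ipC Y X).
by ring.
Qed.

Lemma ip_oppl X Y : ip (- X) Y = - ip X Y.
Proof. by rewrite -scaleN1r ip_scalell mulN1r. Qed.

(** The second derivative Z of the Gauss map drops out, because [N, Z] is orthogonal to N by
    cyclicity of the trace; only products of X and Y remain. *)
Lemma ip_second N X Y Z a b : S21 N ->
  Y *m N = - (N *m Y) ->
  ip ((2 * b) *: (N *m Y) *m ((2 * a) *: (N *m X)) + a *: (lie Y X + lie N Z)) N =
  - (4 * b * a) * ip (Y *m X) N + a * (ip (Y *m X) N - ip (X *m Y) N).
Proof.
move=> N1 YN; have [N0 _] := N1.
have lieN : ip (lie N Z) N = 0.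
  rewrite ip_sl2// /lie mulmxBl linearB/= -mulmxA mxtrace_mulC.
  by rewrite subrr mulr0.
rewrite (normal_cancel N1)// ip_addl !ip_scalell ip_addl lieN addr0.
by rewrite /lie ip_addl ip_oppl; ring.
Qed.

(** det II = -(r s rho t)^2 and det I = (r s)^2 (E G - F^2) = -(r s t)^2. *)
Lemma curvature_ratio (MI MII : 'M[R]_2) (rho E F G t : R) :
  let r := (1 + rho)^-1 in let s := (1 - rho)^-1 in
  1 + rho != 0 -> 1 - rho != 0 -> t != 0 -> E * G - F ^+ 2 = - t ^+ 2 ->
  MI 0 0 = - (r ^+ 2 * E) -> MI 0 1 = - (r * s * F) ->
  MI 1 0 = - (r * s * F) -> MI 1 1 = - (s ^+ 2 * G) ->
  MII 0 0 = 0 -> MII 0 1 = r * s * rho * t -> MII 1 0 = r * s * rho * t ->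
  MII 1 1 = 0 -> \det MII / \det MI - 1 + 1 = rho ^+ 2.
Proof.
move=> r s r0 s0 t0 gram i00 i01 i10 i11 h00 h01 h10 h11.
rewrite subrK !det2 i00 i01 i10 i11 h00 h01 h10 h11.
have -> : - (r ^+ 2 * E) * - (s ^+ 2 * G) - - (r * s * F) * - (r * s * F)
   = (r * s) ^+ 2 * (E * G - F ^+ 2) by ring.
rewrite gram /r /s; field.
by rewrite t0 s0 r0.
Qed.

Lemma mulmx_det_inj C X Y : \det C = -1 -> C *m X = C *m Y -> X = Y.
Proof.
move=> C1 /(congr1 (mulmx (mxbar C))); rewrite !mulmxA !mxbar_mulmxl C1 !mul_scalar_mx.
by apply: scalerI; rewrite oppr_eq0 oner_eq0.
Qed.

Lemma combination_inj X Y r s v w : r != 0 -> s != 0 ->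
  (forall x y : R, x *: X + y *: Y = 0 -> x = 0 /\ y = 0) ->
  v.1 *: (r *: X) + v.2 *: (s *: Y) = w.1 *: (r *: X) + w.2 *: (s *: Y) -> v = w.
Proof.
move=> r0 s0 free vw; have [] := free ((v.1 - w.1) * r) ((v.2 - w.2) * s).
  by apply/eqP; rewrite -!scalerA !scalerBl addrACA -opprD subr_eq0; exact/eqP.
move=> /eqP + /eqP; rewrite !mulf_eq0 (negPf r0) (negPf s0) !orbF !subr_eq0.
by case: v w {vw} => [v1 v2] [w1 w2] /= /eqP-> /eqP->.
Qed.

Lemma ip_mulmx_sl2 C X : sl2 X -> ip C (C *m X) = 0.
Proof. by move=> X0; rewrite -{1}(mulmx1 C) ip_mulmxl ip_scalar// mulr0. Qed.

Lemma combination_sl2 X Y (x y r s : R) : sl2 X -> sl2 Y ->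
  sl2 (x *: (r *: X) + y *: (s *: Y)).
Proof.
by rewrite /sl2/= => X0 Y0; rewrite mxtraceD !mxtraceZ X0 Y0 !mulr0 addr0.
Qed.

Lemma quad_form_e1 (e f g : R) :
  e * (1 * 1) + f * (1 * 0 + 0 * 1) + g * (0 * 0) = e /\
  e * (1 * 0) + f * (1 * 1 + 0 * 0) + g * (0 * 1) = f.
Proof. by split; ring. Qed.

Lemma quad_form_e2 (e f g : R) :
  e * (0 * 1) + f * (0 * 0 + 1 * 1) + g * (1 * 0) = f /\
  e * (0 * 0) + f * (0 * 1 + 1 * 0) + g * (1 * 1) = g.
Proof. by split; ring. Qed.

(** With 2 a = r and 2 b = s the left side is r (s - 1) t, and s - 1 = s rho. The transposed entry
    below is s (1 - r) t, and 1 - r = r rho. *)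
Lemma second_value01 (rho t u v : R) :
  let a := (2 * (1 + rho))^-1 in let b := (2 * (1 - rho))^-1 in
  1 + rho != 0 -> 1 - rho != 0 -> u = - t -> v = t ->
  - (4 * b * a) * u + a * (u - v) = (1 + rho)^-1 * (1 - rho)^-1 * rho * t.
Proof. by move=> a b r0 s0 -> ->; rewrite /a /b; field; rewrite r0 s0. Qed.

Lemma second_value10 (rho t u v : R) :
  let a := (2 * (1 + rho))^-1 in let b := (2 * (1 - rho))^-1 in
  1 + rho != 0 -> 1 - rho != 0 -> u = - t -> v = t ->
  - (4 * a * b) * v + b * (v - u) = (1 + rho)^-1 * (1 - rho)^-1 * rho * t.
Proof. by move=> a b r0 s0 -> ->; rewrite /a /b; field; rewrite r0 s0. Qed.

Lemma half_eq (x y : R) : x = 1 / y -> (2 * y)^-1 = x / 2.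
Proof. by move=> ->; rewrite invfM mul1r mulrC. Qed.

Lemma half_inj (x y : R) : (2 * y)^-1 = x / 2 -> x = 1 / y.
Proof.
by rewrite invfM mulrC mul1r => /(mulIf _) -> //; rewrite invr_eq0 pnatr_eq0.
Qed.

Lemma scale_injr (V : lmodType R) (x y : R) (M : V) : M != 0 -> x *: M = y *: M -> x = y.
Proof.
move=> M0 /eqP; rewrite -subr_eq0 -scalerBl scaler_eq0 (negPf M0) orbF subr_eq0.
by move/eqP.
Qed.

Lemma combination_e1 (X Y : 'M[R]_2) : ((1 : R), (0 : R)).1 *: X + ((1 : R), (0 : R)).2 *: Y = X.
Proof. by rewrite scale1r scale0r addr0. Qed.

Lemma combination_e2 (X Y : 'M[R]_2) : ((0 : R), (1 : R)).1 *: X + ((0 : R), (1 : R)).2 *: Y = Y.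
Proof. by rewrite scale1r scale0r add0r. Qed.

Lemma gram_lt0 (E F G t r s : R) : E * G - F ^+ 2 = - t ^+ 2 ->
  t != 0 -> r != 0 -> s != 0 ->
  - (r ^+ 2 * E) * - (s ^+ 2 * G) - (- (r * s * F)) ^+ 2 < 0.
Proof.
move=> gram t0 r0 s0.
have -> : - (r ^+ 2 * E) * - (s ^+ 2 * G) - (- (r * s * F)) ^+ 2 =
    (r * s) ^+ 2 * (E * G - F ^+ 2) by ring.
by rewrite gram mulrN oppr_lt0 mulr_gt0// exprn_even_gt0//= ?mulf_neq0.
Qed.

(** The commutator is 2 N X and N is its own inverse. This is what makes the constants r and s
    unique. *)
Lemma lie_neq0 N X : S21 N -> N *m X + X *m N = 0 -> X != 0 -> lie N X != 0.
Proof.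
move=> N1 NX; apply: contraNneq; rewrite lie_anticomm// => /eqP.
rewrite scaler_eq0 pnatr_eq0/= => /eqP NX0.
by rewrite -(mul1mx X) -(S21_sqr N1) -mulmxA NX0 mulmx0.
Qed.

End PointwiseGeometry.

(** * The immersion obtained from the Gauss map *)

Section Immersion.
Context {R : realType} (Omega : set (R * R)) (nu f : R * R -> 'M[R]_2) (rho : R).
Hypotheses (oO : open Omega) (nuS : maps_into Omega nu (@S21 R)).
Hypothesis nui : immersion_on Omega nu.
Hypothesis nuh : harmonic Omega nu.
Hypotheses (rho1 : 1 + rho != 0) (rho2 : 1 - rho != 0).
Let r := (1 + rho)^-1.
Let s := (1 - rho)^-1.
Let a := (2 * (1 + rho))^-1.
Let b := (2 * (1 - rho))^-1.
Let A := conn nu a ord0.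
Let B := conn nu b ord_max.

(** Both sides of [a + b = 4 * a * b] equal 1 / ((1 + rho) (1 - rho)). *)
Lemma coef_flat : flat_sl2 Omega A B.
Proof. by apply: conn_flat => //; rewrite /a /b; field; rewrite rho1 rho2. Qed.

Hypothesis pf : forall p, Omega p -> parallel A B f p.

Lemma two_a : 2 * a = r. Proof. by rewrite /a /r; field. Qed.
Lemma two_b : 2 * b = s. Proof. by rewrite /b /s; field. Qed.

Lemma frame_det p : Omega p -> \det (f p) = 1. Proof. by case/pf. Qed.

Lemma frame_inv p : Omega p -> invmx (f p) *m f p = 1%:M.
Proof. by move=> Op; rewrite mulVmx// unitmxE frame_det// unitr1. Qed.

Lemma normal_det p : Omega p -> \det (f p *m nu p) = -1.
Proof.
move=> Op; rewrite det_mulmx frame_det// mul1r.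
by have [_ ] := nuS Op; rewrite ip_det => /eqP; rewrite eqr_oppLR => /eqP.
Qed.

Lemma frame_diffE p v : Omega p ->
  'd f p v = f p *m nu p *m (v.1 *: (r *: dx nu p) + v.2 *: (s *: dy nu p)).
Proof.
move=> Op; have [_ E _] := pf Op; apply: etrans (E v) _.
have EA : A p = (2 * a) *: (nu p *m dx nu p) := connE oO nuS nui a ord0 Op.
have EB : B p = (2 * b) *: (nu p *m dy nu p) := connE oO nuS nui b ord_max Op.
rewrite EA EB two_a two_b.
exact: mulmx_combination.
Qed.

Lemma fstffE p v w : Omega p -> fstff f p v w =
  (- (r ^+ 2 * ip (dx nu p) (dx nu p))) * (v.1 * w.1)
  + (- (r * s * ip (dx nu p) (dy nu p))) * (v.1 * w.2 + v.2 * w.1)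
  + (- (s ^+ 2 * ip (dy nu p) (dy nu p))) * (v.2 * w.2).
Proof.
move=> Op; rewrite /fstff !frame_diffE//.
exact/ip_frame/normal_det.
Qed.

Let T p := triple (nu p) (dx nu p) (dy nu p).

Lemma tangent_triple_neq0 p : Omega p -> T p != 0.
Proof.
move=> Op; apply: triple_neq0.
- exact: nuS.
- exact: (nu_pd_sl2 oO nuS nui ord0 Op).
- exact: (nu_pd_sl2 oO nuS nui ord_max Op).
- exact: (nu_anticomm oO nuS nui ord0 Op).
- exact: (nu_anticomm oO nuS nui ord_max Op).
- exact: (nu_free nui Op).
Qed.

Lemma tangent_gram p : Omega p -> ip (dx nu p) (dx nu p) * ip (dy nu p) (dy nu p)
  - ip (dx nu p) (dy nu p) ^+ 2 = - T p ^+ 2.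
Proof.
move=> Op; apply: gram_triple.
- exact: nuS.
- exact: (nu_pd_sl2 oO nuS nui ord0 Op).
- exact: (nu_pd_sl2 oO nuS nui ord_max Op).
- exact: (nu_anticomm oO nuS nui ord0 Op).
- exact: (nu_anticomm oO nuS nui ord_max Op).
Qed.

Lemma frame_timelike : timelike_immersion Omega f.
Proof.
have r0 : r != 0 by rewrite invr_eq0.
have s0 : s != 0 by rewrite invr_eq0.
split.
- split; first exact: frame_smooth coef_flat pf.
  move=> p Op v w; rewrite !frame_diffE// => /(mulmx_det_inj (normal_det Op)).
  exact: combination_inj (nu_free nui Op).
- by move=> p Op; rewrite /AdS3/= ip_det frame_det.
- move=> p Op; apply: (lorentzian_det (fun v w => fstffE v w Op)).
  exact: gram_lt0 (tangent_gram Op) (tangent_triple_neq0 Op) r0 s0.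
Qed.

Lemma frame_gauss_map : has_gauss_map Omega f nu.
Proof.
move=> p Op N; have [N0 N1] := nuS Op.
have dfp : differentiable f p by have [] := pf Op.
have orth v : ip N ('d f p v) = 0.
  rewrite frame_diffE//; apply: ip_mulmx_sl2; apply: combination_sl2.
    exact: (nu_pd_sl2 oO nuS nui ord0 Op).
  exact: (nu_pd_sl2 oO nuS nui ord_max Op).
split.
- by rewrite ip_det normal_det// opprK.
- by rewrite ipC; exact: ip_mulmx_sl2.
- by apply: etrans (orth (1, 0)); congr (ip _ _); exact: deriveE.
- by apply: etrans (orth (0, 1)); congr (ip _ _); exact: deriveE.
Qed.

Definition conn_weight (i : 'I_2) := if i == ord0 then a else b.

Lemma ord_max1 : ord_max = 1 :> 'I_2. Proof. exact: val_inj. Qed.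

Lemma coef_conn i : coef A B i = conn nu (conn_weight i) i.
Proof. by move: i; apply: ord2P => //=; rewrite -ord_max1. Qed.

Lemma second_form i j p : Omega p ->
  ip (pd j (pd i f) p) (normal_of f nu p) =
  - (4 * conn_weight j * conn_weight i) * ip (pd j nu p *m pd i nu p) (nu p)
  + conn_weight i * (ip (pd j nu p *m pd i nu p) (nu p) - ip (pd i nu p *m pd j nu p) (nu p)).
Proof.
move=> Op; rewrite (frame_pd_pd coef_flat pf)// /normal_of ip_mulmxl frame_det// mul1r.
rewrite !coef_conn.
have Ei := connE oO nuS nui (conn_weight i) i Op; have Ej := connE oO nuS nui (conn_weight j) j Op.
rewrite Ei Ej.
apply: etrans (congr1 (fun W => ip ((2 * conn_weight j) *: (nu p *m pd j nu p) *m
  ((2 * conn_weight i) *: (nu p *m pd i nu p)) + W) (nu p)) (pd_conn nui (conn_weight i) i j Op)) _.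
apply: ip_second; first exact: nuS.
exact: anticommX (nu_anticomm oO nuS nui j Op).
Qed.

Lemma frame_curvature p : Omega p -> gauss_curvature f nu p + 1 = rho ^+ 2.
Proof.
move=> Op.
have N1 := nuS Op.
have X0 := nu_pd_sl2 oO nuS nui ord0 Op; have Y0 := nu_pd_sl2 oO nuS nui ord_max Op.
have tXY : ip (pd ord_max nu p *m pd ord0 nu p) (nu p) = - T p.
  exact: triple_swap.
(* Antisymmetry of the triple product with both tangent vectors equal; this makes the diagonal of
   the second fundamental form vanish, so x and y are asymptotic coordinates. *)
have tii i : ip (pd i nu p *m pd i nu p) (nu p) = 0.
  have Z0 := nu_pd_sl2 oO nuS nui i Op.
  have := triple_swap N1 Z0 Z0; rewrite /triple; move: (ip _ _) => t /eqP.
  by rewrite -addr_eq0 -mulr2n mulrn_eq0 => /eqP.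
have tYX : ip (pd ord0 nu p *m pd ord_max nu p) (nu p) = T p by [].
have II i j := etrans (mxE _ _ i j : matII f nu p i j = _) (second_form i j Op).
have II0 i : matII f nu p i i = 0.
  by apply: etrans (II i i) _; rewrite tii subrr !mulr0 addr0.
have form i j := etrans (mxE _ _ i j : matI f p i j = _) (fstffE (dir R i) (dir R j) Op).
apply: (@curvature_ratio _ _ _ rho _ _ _ (T p) rho1 rho2
  (tangent_triple_neq0 Op) (tangent_gram Op)).
- by apply: etrans (form 0 0) (quad_form_e1 _ _ _).1.
- by apply: etrans (form 0 1) (quad_form_e1 _ _ _).2.
- by apply: etrans (form 1 0) (quad_form_e2 _ _ _).1.
- by apply: etrans (form 1 1) (quad_form_e2 _ _ _).2.
- exact: II0.
- rewrite -ord_max1; apply: etrans (II ord0 ord_max) _.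
  exact: (second_value01 rho1 rho2 tXY tYX).
- rewrite -ord_max1; apply: etrans (II ord_max ord0) _.
  exact: (second_value10 rho1 rho2 tXY tYX).
- exact: II0.
Qed.

Lemma frame_pullback p v : Omega p -> invmx (f p) *m 'd f p v = alpha rho nu p v.
Proof.
move=> Op; have [_ E _] := pf Op.
apply: etrans (congr1 (mulmx (invmx (f p))) (E v)) _.
by rewrite mulmxA frame_inv// mul1mx.
Qed.

(** The converse direction compares coefficients of [nu, nu_x] and [nu, nu_y], which are nonzero
    because nu is an immersion. *)
Lemma frame_constants p (x y : R) : Omega p ->
  (invmx (f p) *m dx f p = (x / 2) *: lie (nu p) (dx nu p) /\
   invmx (f p) *m dy f p = (y / 2) *: lie (nu p) (dy nu p)) <->
  (x = 1 / (1 + rho) /\ y = 1 / (1 - rho)).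
Proof.
move=> Op; have dfp : differentiable f p by have [] := pf Op.
have Ex : invmx (f p) *m dx f p = a *: lie (nu p) (dx nu p).
  apply: etrans (congr1 (mulmx (invmx (f p))) (deriveE ((1, 0) : R * R) dfp)) _.
  by apply: etrans (frame_pullback (1, 0) Op) _; exact: combination_e1.
have Ey : invmx (f p) *m dy f p = b *: lie (nu p) (dy nu p).
  apply: etrans (congr1 (mulmx (invmx (f p))) (deriveE ((0, 1) : R * R) dfp)) _.
  by apply: etrans (frame_pullback (0, 1) Op) _; exact: combination_e2.
have free := nu_free nui Op.
have Lx : lie (nu p) (dx nu p) != 0.
  apply: (lie_neq0 (nuS Op) (nu_anticomm oO nuS nui ord0 Op)); apply/eqP => X0.
  have [] := free 1 0; last by move/eqP; rewrite oner_eq0.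
  by apply: etrans (congr1 (fun X => 1 *: X + 0 *: dy nu p) X0) _; rewrite scaler0 scale0r addr0.
have Ly : lie (nu p) (dy nu p) != 0.
  apply: (lie_neq0 (nuS Op) (nu_anticomm oO nuS nui ord_max Op)); apply/eqP => Y0.
  have [] := free 0 1; last by move=> _ /eqP; rewrite oner_eq0.
  by apply: etrans (congr1 (fun Y => 0 *: dx nu p + 1 *: Y) Y0) _; rewrite scaler0 scale0r addr0.
split=> [[hx hy]|[hx hy]].
  split; apply: half_inj.
    exact: scale_injr Lx (etrans (esym Ex) hx).
  exact: scale_injr Ly (etrans (esym Ey) hy).
split.
  exact: etrans Ex (congr1 (fun c => c *: lie (nu p) (dx nu p)) (half_eq hx)).
exact: etrans Ey (congr1 (fun c => c *: lie (nu p) (dy nu p)) (half_eq hy)).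
Qed.

End Immersion.

Theorem proposition4p5 (R : realType) (Omega : set (R * R))
    (nu : R * R -> 'M[R]_2) (rho : R) :
  open Omega -> simply_connected R Omega ->
  maps_into Omega nu (@S21 R) -> immersion_on Omega nu -> harmonic Omega nu ->
  rho != 0 -> rho != 1 -> rho != -1 ->
  exists f : R * R -> 'M[R]_2,
    [/\ timelike_immersion Omega f,
        has_gauss_map Omega f nu,
        (forall p, Omega p -> gauss_curvature f nu p + 1 = rho ^+ 2),
        (forall p, Omega p -> forall v : R * R,
           invmx (f p) *m 'd f p v = alpha rho nu p v) &
        (forall p, Omega p -> forall r s : R,
           (invmx (f p) *m dx f p = (r / 2) *: lie (nu p) (dx nu p) /\
            invmx (f p) *m dy f p = (s / 2) *: lie (nu p) (dy nu p)) <->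
           (r = 1 / (1 + rho) /\ s = 1 / (1 - rho)))].
Proof.
move=> oO scO nuS nui nuh _ rho_neq1 rho_neqN1.
have rho1 : 1 + rho != 0 by rewrite addrC addr_eq0.
have rho2 : 1 - rho != 0 by rewrite subr_eq0 eq_sym.
have [f pf] := flat_integrable (coef_flat oO nuS nui nuh rho1 rho2) scO.
exists f; split.
- exact: (frame_timelike oO nuS nui nuh rho1 rho2 pf).
- exact: (frame_gauss_map oO nuS nui rho1 rho2 pf).
- by move=> p; exact: (frame_curvature oO nuS nui nuh rho1 rho2 pf).
- by move=> p Op v; exact: (frame_pullback pf).
- by move=> p Op r s; exact: (frame_constants oO nuS nui pf).
Qed.
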